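(* For each $n\in\mathbb{N}$ let $(\mathcal{M}^{n}_t)_{t\ge0}$ be a monotone Mallows process on $\mathcal{S}_n$ with jumping times $T_1,\dots,T_{\binom n2}$ (depending on $n$). Then for every fixed $k\in\mathbb{N}$, as $n\to\infty$, $nT_k$ converges in distribution to a $\mathrm{Gamma}(k,1)$ random variable. Moreover, if each $(\mathcal{M}^n_t)_{t\ge0}$ is regular, then for every fixed $k\in\mathbb{N}$, $(nT_1,\dots,nT_k)$ converges in distribution, as $n\to\infty$, to the law of the first $k$ points of a homogeneous Poisson point process on $[0,\infty)$ with rate $1$.
   Context: $\mathrm{Inv}(\sigma)=|\{i<j:\sigma(i)>\sigma(j)\}|$, $\mathrm{Inv}_j(\sigma)=|\{i\in[j-1]:\sigma(i)>\sigma(j)\}|$ for $\sigma\in\mathcal{S}_n$. The Mallows distribution $\pi_{n,q}(\sigma)=q^{\mathrm{Inv}(\sigma)}/\prod_{k=1}^n\sum_{\ell=0}^{k-1}q^\ell$ ($0^0=1$). A Mallows process is an $\mathcal{S}_n$-valued càdlàg process with $\mathcal{M}_t\sim\pi_{n,t}$ for every $t\ge0$. It is monotone if $\mathrm{Inv}(\mathcal{M}_t)\le\mathrm{Inv}(\mathcal{M}_{t'})$ for all $t<t'$; strongly monotone if $t\mapsto\mathrm{Inv}_j(\mathcal{M}_t)$ is nondecreasing for each $j$; smooth if strongly monotone and $\mathrm{Inv}(\mathcal{M}_t)\le\mathrm{Inv}(\mathcal{M}_{t-})+1$ for all $t$; regular if smooth and the processes $(\mathrm{Inv}_j(\mathcal{M}_t))_{t\ge0}$,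 $j\in[n]$, are mutually independent. For a monotone Mallows process, the jumping times are $T_k=\inf\{t\ge0:\mathrm{Inv}(\mathcal{M}_t)\ge k\}$ for $0\le k\le\binom n2$. *)

(* Defs.v *)
From HB Require Import structures.
From mathcomp Require Import all_boot all_order all_algebra all_fingroup.
From mathcomp Require Import all_classical all_reals all_analysis.
Set Implicit Arguments. Unset Strict Implicit. Unset Printing Implicit Defensive.
Import Order.TTheory GRing.Theory Num.Theory.
Import numFieldNormedType.Exports.
Local Open Scope classical_set_scope.
Local Open Scope ring_scope.

Definition Inv (n : nat) (s : 'S_n) : nat :=
  #|[set p : 'I_n * 'I_n | (p.1 < p.2)%N && (s p.2 < s p.1)%N]|.

Definition Invj (n : nat) (s : 'S_n) (j : 'I_n) : nat :=
  #|[set i : 'I_n | (i < j)%N && (s j < s i)%N]|.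

Section Defs.
Context {R : realType}.

Definition mallows_Z (n : nat) (q : R) : R := \prod_(k < n) \sum_(l < k.+1) q ^+ l.

(* Mallows distribution pi_{n,q}; note 0 ^+ 0 = 1 *)
Definition mallows (n : nat) (q : R) (s : 'S_n) : R := q ^+ Inv s / mallows_Z n q.

Definition left_lim (T : Type) (X : R -> T) (t : R) (x : T) : Prop :=
  exists2 e : R, 0 < e /\ e <= t & forall s, t - e < s -> s < t -> X s = x.

(* cadlag path on [0, oo) with values in a discrete space *)
Definition cadlag (T : Type) (X : R -> T) : Prop :=
  (forall t, 0 <= t -> exists2 e : R, 0 < e & forall s, t <= s -> s < t + e -> X s = X t) /\
  (forall t, 0 < t -> exists x, left_lim X t x).

Section Process.
Context {d : measure_display} {Omega : measurableType d} (P : probability Omega R).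

Definition mallows_process (n : nat) (M : Omega -> R -> 'S_n) : Prop :=
  (forall w, cadlag (M w)) /\
  (forall t (s : 'S_n), 0 <= t -> measurable [set w | M w t = s]) /\
  (forall t (s : 'S_n), 0 <= t -> P [set w | M w t = s] = (mallows t s)%:E).

Definition monotone_mallows (n : nat) (M : Omega -> R -> 'S_n) : Prop :=
  mallows_process M /\
  forall w t t', 0 <= t -> t < t' -> (Inv (M w t) <= Inv (M w t'))%N.

Definition strongly_monotone_mallows (n : nat) (M : Omega -> R -> 'S_n) : Prop :=
  mallows_process M /\
  forall w (j : 'I_n) t t', 0 <= t -> t < t' -> (Invj (M w t) j <= Invj (M w t') j)%N.

(* at t = 0 the left limit is M_0 by convention, so only t > 0 matters *)
Definition smooth_mallows (n : nat) (M : Omega -> R -> 'S_n) : Prop :=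
  strongly_monotone_mallows M /\
  forall w t x, 0 < t -> left_lim (M w) t x -> (Inv (M w t) <= (Inv x).+1)%N.

(* mutual independence of the processes (Inv_j(M_t))_{t >= 0}, j in [n]:
   product rule for all finite-dimensional cylinder events *)
Definition inv_processes_independent (n : nat) (M : Omega -> R -> 'S_n) : Prop :=
  forall (ts : seq R) (B : 'I_n -> set (seq nat)),
    (forall t, t \in ts -> 0 <= t) ->
    P (\bigcap_(j in [set: 'I_n]) [set w | B j [seq Invj (M w t) j | t <- ts]])
    = (\prod_(j < n) P [set w | B j [seq Invj (M w t) j | t <- ts]])%E.

Definition regular_mallows (n : nat) (M : Omega -> R -> 'S_n) : Prop :=
  smooth_mallows M /\ inv_processes_independent M.

(* Poisson probability mass with mean m >= 0 (0^0 = 1) *)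
Definition poisson_mass (m : R) (a : nat) : R := m ^+ a / a`!%:R * expR (- m).

Definition poisson_process (N : Omega -> R -> nat) : Prop :=
  (forall w, N w 0 = 0%N) /\
  (forall w s t, 0 <= s -> s <= t -> (N w s <= N w t)%N) /\
  (forall w t, 0 <= t -> exists2 e : R, 0 < e & forall s, t <= s -> s < t + e -> N w s = N w t) /\
  (forall t (a : nat), 0 <= t -> measurable [set w | N w t = a]) /\
  (forall (ts : seq R) (a : seq nat),
    size a = size ts -> sorted <=%R (0 :: ts) ->
    P [set w | forall i, (i < size ts)%N ->
        (N w (nth 0%R (0%R :: ts) i.+1) - N w (nth 0%R (0%R :: ts) i))%N = nth 0%N a i]
    = (\prod_(i < size ts)
         (poisson_mass (nth 0 (0 :: ts) i.+1 - nth 0 (0 :: ts) i) (nth 0%N a i))%:E)%E).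

End Process.

Definition jump_time (n : nat) (X : R -> 'S_n) (k : nat) : R :=
  inf [set t | 0 <= t /\ (k <= Inv (X t))%N].

Definition kth_point (N : R -> nat) (k : nat) : R :=
  inf [set t | 0 <= t /\ (k <= N t)%N].

Definition gamma_pdf (k : nat) (x : R) : R :=
  x ^+ k.-1 * expR (- x) / (k.-1)`!%:R.

End Defs.

(* Main.v *)
(* Since [n T_k <= x] iff [Inv (M_(x/n)) >= k] almost surely, the limit laws of
   the jump times are read off the limits of the counts [Inv (M_(x/n))].  These
   are identified through the Laplace functionals [E 2 ^ (- \sum_l r_l N(x_l))],
   [r_l] natural numbers: their values determine and control uniformly the masses
   of the vector [(N(x_l))_l].
   For a single time, [E z ^ Inv (M_q) = Z_n(z q) / Z_n(q)] because the Mallows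
   weights sum to 1, and [Z_n(x/n)] tends to [e ^ x]; this yields the Poisson
   law, whose tails integrate to the Gamma law.
   In the regular case the functional is a product over j of independent factors.
   By the Lehmer code bijection each Inv_j(M_q) is a truncated geometric
   variable, so up to O(1/n^2) the j-th process makes at most one jump before
   time x/n, at a time with density close to 1; each factor is then
   [1 - c/n + O(1/n^2)] with [e ^ (- c)] the functional of a Poisson process. *)
Require Import Defs.
From HB Require Import structures.
From mathcomp Require Import all_boot all_order all_algebra all_fingroup.
From mathcomp Require Import all_classical all_reals all_analysis.
From mathcomp Require Import measurable_realfun.
From mathcomp Require Import ring lra zify.
Set Implicit Arguments. Unset Strict Implicit. Unset Printing Implicit Defensive.
Import Order.TTheory GRing.Theory Num.Theory.
Import numFieldNormedType.Exports.
Local Open Scope classical_set_scope.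
Local Open Scope ring_scope.

(** * Bounded random variables *)

(** The conclusion tests bounded continuous functions of the jump times, whereas the hypotheses
    describe the counts at fixed times. The bridge is the joint distribution function, which a grid
    discretisation turns into weak convergence. The base 1/2 gives functionals with values in [0, 1]
    whose products are again of this form. For [v >= a] the powers of [2 ^ (a - v)] tend to 0 or are
    constantly 1, uniformly in [v]; indicators are therefore uniform limits of such functionals,
    with errors that do not depend on n, and the counts require no separate tightness argument. The
    infimum of the empty set is 0: a path that never reaches level k has jump time 0 rather than
    infinity. Hence the equivalence between times and counts is only almost sure, and it is used for
    n > k, where the level is reached with probability 1. Position [j = 0] carries no inversion, so
    its factor is 1 and not close to [1 - c/n] at order 1/n^2; a single error of order 1/n is
    harmless, while the n - 1 others must be O(1/n^2). The first claim comes with no Poisson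
    process, so its limit variable lives on the real line under the explicit probability
    [gamma_prob]. *)

Section BoundedRandomVariables.
Context {R : realType} {d : measure_display} {T : measurableType d}
  (P : probability T R).
Implicit Types (X Y : T -> R) (A B : set T).

(** Every functional integrated below is bounded; this class is stable under the operations used and
    spares all integrability conditions. *)
Definition brv X := measurable_fun setT X /\ exists C : R, forall w, `|X w| <= C.

Definition Pr A : R := fine (P A).

Definition Ex X : R := \int[P]_w X w.

Lemma brv_integrable X : brv X -> P.-integrable setT (EFin \o X).
Proof.
move=> [mX [C XC]]; apply: measurable_bounded_integrable => //.
  by have := probability_setT P; rewrite /= => ->; rewrite ltry.
exists C; split; first by rewrite num_real.
by move=> x Cx w _; exact: le_trans (XC w) (ltW Cx).
Qed.

Lemma measurable_le_cst X (x : R) :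
  measurable_fun setT X -> measurable [set w | X w <= x].
Proof.
move=> mX; rewrite -[X in measurable X]setTI.
have := mX measurableT _ (measurable_itv `]-oo, x]).
by congr measurable; apply/seteqP; split => w /=; rewrite in_itv.
Qed.

Lemma brv_cst c : brv (fun _ => c).
Proof. by split; [exact: measurable_cst | exists `|c|]. Qed.

Lemma brvD X Y : brv X -> brv Y -> brv (fun w => X w + Y w).
Proof.
move=> [mX [C XC]] [mY [D YD]]; split; first exact: measurable_funD.
exists (C + D) => w; exact: le_trans (ler_normD _ _) (lerD (XC w) (YD w)).
Qed.

Lemma brvM X Y : brv X -> brv Y -> brv (fun w => X w * Y w).
Proof.
move=> [mX [C XC]] [mY [D YD]]; split; first exact: measurable_funM.
by exists (C * D) => w; rewrite normrM ler_pM.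
Qed.

Lemma brvB X Y : brv X -> brv Y -> brv (fun w => X w - Y w).
Proof.
move=> bX bY; have := brvD bX (brvM (brv_cst (-1)) bY).
by congr brv; apply/funext => w; rewrite mulN1r.
Qed.

Lemma brv_sum (I : Type) (r : seq I) (X : I -> T -> R) :
  (forall i, brv (X i)) -> brv (fun w => \sum_(i <- r) X i w).
Proof.
move=> bX; elim: r => [|i r IH].
  by have := brv_cst 0; congr brv; apply/funext => w; rewrite big_nil.
by have := brvD (bX i) IH; congr brv; apply/funext => w; rewrite big_cons.
Qed.

Lemma brv_indic A : measurable A -> brv (\1_A : T -> R).
Proof.
move=> mA; split; first exact: measurable_indic.
by exists 1 => w; rewrite indicE; case: (_ \in _); rewrite ?normr1 ?normr0.
Qed.

Lemma Ex_cst c : Ex (fun _ => c) = c.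
Proof.
rewrite /Ex Rintegral_cst//; have := probability_setT P.
by rewrite /= => ->; rewrite mulr1.
Qed.

Lemma ExD X Y : brv X -> brv Y -> Ex (fun w => X w + Y w) = Ex X + Ex Y.
Proof. by move=> bX bY; rewrite /Ex RintegralD//; exact: brv_integrable. Qed.

Lemma ExZ c X : brv X -> Ex (fun w => c * X w) = c * Ex X.
Proof. by move=> bX; rewrite /Ex RintegralZl//; exact: brv_integrable. Qed.

Lemma ExB X Y : brv X -> brv Y -> Ex (fun w => X w - Y w) = Ex X - Ex Y.
Proof. by move=> bX bY; rewrite /Ex RintegralB//; exact: brv_integrable. Qed.

Lemma Ex_sum (I : Type) (r : seq I) (X : I -> T -> R) :
  (forall i, brv (X i)) -> Ex (fun w => \sum_(i <- r) X i w) = \sum_(i <- r) Ex (X i).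
Proof.
move=> bX; elim: r => [|i r IH].
  by rewrite big_nil -[RHS](Ex_cst 0); congr Ex; apply/funext => w; rewrite big_nil.
rewrite big_cons -IH -ExD//; last exact: brv_sum.
by congr Ex; apply/funext => w; rewrite big_cons.
Qed.

Lemma Ex_le X Y : brv X -> brv Y -> (forall w, X w <= Y w) -> Ex X <= Ex Y.
Proof. by move=> bX bY XY; apply: le_Rintegral => //; exact: brv_integrable. Qed.

Lemma Ex_norm_le X Y : brv X -> brv Y -> (forall w, `|X w| <= Y w) ->
  `|Ex X| <= Ex Y.
Proof.
move=> bX bY XY; apply: le_trans (le_normr_Rintegral _ (brv_integrable bX)) _ => //.
apply: le_Rintegral => //; [|exact: brv_integrable].
case: bX => mX [C XC]; apply: (@brv_integrable (fun w => `|X w|)); split.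
  exact: measurableT_comp.
by exists C => w; rewrite normr_id.
Qed.

Lemma Ex_indic A : measurable A -> Ex \1_A = Pr A.
Proof. by move=> mA; rewrite /Ex /Rintegral integral_indic// setIT. Qed.

Lemma Pr_ge0 A : 0 <= Pr A.
Proof. exact: fine_ge0. Qed.

Lemma PrE A : measurable A -> P A = (Pr A)%:E.
Proof. by move=> mA; rewrite fineK//; exact: fin_num_measure. Qed.

Lemma Pr_setT : Pr setT = 1.
Proof. by rewrite /Pr probability_setT. Qed.

Lemma Pr_setC A : measurable A -> Pr (~` A) = 1 - Pr A.
Proof. by move=> mA; rewrite /Pr probability_setC// PrE// -EFinB. Qed.

Lemma Pr_le A B : measurable A -> measurable B -> A `<=` B -> Pr A <= Pr B.
Proof.
by move=> mA mB AB; rewrite -lee_fin -!PrE//; apply: le_measure; rewrite ?inE.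
Qed.

Lemma Pr_setDI A B : measurable A -> measurable B ->
  Pr (A `\` B) = Pr A - Pr (A `&` B).
Proof.
move=> mA mB; rewrite -!Ex_indic; [|by do ?[exact: measurableD|exact: measurableI]..].
rewrite -ExB; [|by apply: brv_indic; do ?exact: measurableI..].
congr Ex; apply/funext => w /=; rewrite !indicE in_setD in_setI.
by case: (w \in A); case: (w \in B); rewrite /= ?subr0 ?subrr.
Qed.

(** The indicators of [A] and [B] differ by at most that of [Z], so the probabilities differ by at
    most [Pr Z]. *)
Lemma Pr_eq_ae A B Z : measurable A -> measurable B -> measurable Z -> Pr Z = 0 ->
  (forall w, ~ Z w -> A w <-> B w) -> Pr A = Pr B.
Proof.
move=> mA mB mZ Z0 AB; apply/eqP; rewrite -subr_eq0 -normr_le0.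
rewrite -!Ex_indic// -ExB; [|exact: brv_indic..].
rewrite -Z0 -Ex_indic//; apply: Ex_norm_le; [|exact: brv_indic|].
  by apply: brvB; exact: brv_indic.
move=> w; rewrite !indicE; have [|] := pselect (Z w).
  by move=> Zw; rewrite (mem_set Zw); case: (_ \in _); case: (_ \in _);
    by rewrite /= ?subrr ?subr0 ?sub0r ?normrN ?normr0 ?normr1.
move=> Zw; have [Aw|nAw] := pselect (A w).
  by rewrite (mem_set Aw) (mem_set ((AB _ Zw).1 Aw)) subrr normr0; case: (_ \in _).
rewrite (memNset nAw) memNset ?subrr ?normr0 ?(memNset Zw)//.
by move/(AB _ Zw).2.
Qed.

End BoundedRandomVariables.

(** * Variables with values in a countable type *)

Section DiscreteRandomVariables.
Context {R : realType} {d : measure_display} {T : measurableType d}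
  (P : probability T R).

(** [S] is an arbitrary set: its preimage is a union of fibres of [xi], made countable by indexing
    them with their [pickle] codes. *)
Lemma measurable_preimage_count (U : countType) (xi : T -> U) (S : set U) :
  (forall u, measurable [set w | xi w = u]) -> measurable [set w | S (xi w)].
Proof.
move=> mxi.
have -> : [set w | S (xi w)] =
    \bigcup_n [set w | exists u, [/\ unpickle n = Some u, S u & xi w = u]].
  apply/seteqP; split => w /=.
    by move=> Sw; exists (pickle (xi w)) => //=; exists (xi w); rewrite pickleK.
  by move=> [n _ [u [_ Su ->]]].
apply: bigcup_measurable => n _.
case Eu : (@unpickle U n) => [u|].
  have [Su|nSu] := pselect (S u).
    rewrite (_ : [set _ | _] = [set w | xi w = u])//.
    apply/seteqP; split => w /=; first by move=> [v [[->]]].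
    by move=> ->; exists u.
  rewrite (_ : [set _ | _] = set0)//; apply/seteqP; split => w //=.
  by move=> [v [[<-]]].
rewrite (_ : [set _ | _] = set0)//; apply/seteqP; split => w //=.
by move=> [v []].
Qed.

Lemma measurable_fun_count (U : countType) (xi : T -> U) (g : U -> R) :
  (forall u, measurable [set w | xi w = u]) -> measurable_fun setT (fun w => g (xi w)).
Proof.
move=> mxi _ B mB; rewrite setTI.
exact: (measurable_preimage_count (g @^-1` B) mxi).
Qed.

Lemma brv_count (U : countType) (xi : T -> U) (g : U -> R) (C : R) :
  (forall u, measurable [set w | xi w = u]) -> (forall u, `|g u| <= C) ->
  brv (fun w => g (xi w)).
Proof. by move=> mxi gC; split; [exact: measurable_fun_count|exists C]. Qed.

Lemma brv_fin (U : finType) (xi : T -> U) (g : U -> R) :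
  (forall u, measurable [set w | xi w = u]) -> brv (fun w => g (xi w)).
Proof.
move=> mxi; apply: (@brv_count _ _ _ (\sum_u `|g u|)) => // u.
by rewrite (bigD1 u)//= lerDl sumr_ge0.
Qed.

Lemma Ex_fin (U : finType) (xi : T -> U) (g : U -> R) :
  (forall u, measurable [set w | xi w = u]) ->
  Ex P (fun w => g (xi w)) = \sum_u g u * Pr P [set w | xi w = u].
Proof.
move=> mxi.
transitivity (Ex P (fun w => \sum_u g u * \1_[set w | xi w = u] w)).
  congr Ex; apply/funext => w; rewrite (bigD1 (xi w))//= indicE mem_set// mulr1.
  rewrite big1 ?addr0// => u /eqP uw; rewrite indicE memNset ?mulr0//=.
  by move=> E; apply: uw.
rewrite Ex_sum => [|u]; last by apply: brvM; [exact: brv_cst|exact: brv_indic].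
by apply: eq_bigr => u _; rewrite ExZ ?Ex_indic//; exact: brv_indic.
Qed.

End DiscreteRandomVariables.

(** * Weak convergence from joint distribution functions *)

Section WeakConvergence.
Context {R : realType}.

(** Heine-Cantor from the compactness of the box. Only [y] is confined to it, so nothing has to be
    checked about the approximating point [z]. *)
Lemma continuous_unif_box k (f : 'rV[R]_k -> R) (A e : R) : continuous f -> 0 < e ->
  exists2 dlt : R, 0 < dlt & forall y z : 'rV[R]_k, (forall i, 0 <= y 0 i <= A) ->
    (forall i, `|y 0 i - z 0 i| < dlt) -> `|f y - f z| < e.
Proof.
move=> cf e0.
have cK : compact [set v : 'rV[R]_k | forall i, `[0, A]%classic (v ord0 i)].
  by apply: (@rV_compact R k (fun=> `[0, A]%classic)) => i; exact: segment_compact.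
pose P (dlt : R) (y : 'rV[R]_k) :=
  forall z : 'rV[R]_k, (forall i, `|y 0 i - z 0 i| < dlt) -> `|f y - f z| < e.
move/compact_near_coveringP/(_ R (0 : R)^'+ P _) : cK => cK.
have : forall x : 'rV[R]_k, [set v : 'rV[R]_k | forall i, `[0, A]%classic (v ord0 i)] x ->
    \forall x' \near x & dlt \near (0 : R)^'+, P dlt x'.
  move=> x _; have := cf x => /cvgrPdist_lt/(_ (e / 2)).
  rewrite divr_gt0// => /(_ isT) /nbhs_ballP[r /= r0 rP].
  exists (ball x (r / 2), [set dlt | dlt < r / 2]) => /=.
    by split; [by apply/nbhs_ballP; exists (r / 2) => //=; rewrite divr_gt0|apply: nbhs_right_lt; rewrite divr_gt0].
  move=> [y dlt] /= [xy dr] z yz.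
  have xz : ball x r z.
    rewrite [r]splitr; apply: ball_triangle xy _; split; first by rewrite divr_gt0.
    by move=> i j; rewrite [i]ord1; exact: lt_trans (yz j) dr.
  have xy' : ball x r y by apply: le_ball xy; rewrite ler_pdivrMr//; lra.
  have := rP _ xz; have := rP _ xy' => /= H1 H2.
  have := ler_distD (f x) (f y) (f z); rewrite (distrC (f y) (f x)); lra.
move=> /cK; rewrite nearE => -[dl /= dl0 H].
exists (dl / 2); first by rewrite divr_gt0.
move=> y z yA yz; apply: (H (dl / 2)) => //=.
- by rewrite sub0r normrN gtr0_norm ?divr_gt0// ltr_pdivrMr//; lra.
- by rewrite divr_gt0.
Qed.

(** Prescribing which tests succeed ([s]) and which fail ([t]) yields in particular the atoms of the
    algebra generated by finitely many events. *)
Definition all_tests (I : Type) (T : Type) (tst : T -> I -> bool) (s t : seq I) : set T :=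
  [set w | all (tst w) s && all (fun i => ~~ tst w i) t].

Lemma measurable_all_tests (I : Type) d (T : measurableType d) (tst : T -> I -> bool)
    (D : pred I) s t : (forall i, D i -> measurable [set w | tst w i]) ->
  all D s -> all D t -> measurable (all_tests tst s t).
Proof.
move=> mt; rewrite /all_tests; elim: s => [_|i s IH /= /andP[Di Ds] Dt].
  elim: t => [_|i t IH /= /andP[Di Dt]].
    by rewrite (_ : [set w | _] = setT)//; apply/seteqP; split.
  rewrite (_ : [set w | _] =
      ~` [set w | tst w i] `&` [set w | all (tst w) [::] && all (fun i => ~~ tst w i) t]).
    by apply: measurableI; [apply/measurableC/mt|exact: IH].
  apply/seteqP; split => w /=; first by case/andP => /negP.
  by move=> [/negP -> ->].
rewrite (_ : [set w | _] = [set w | tst w i] `&`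
    [set w | all (tst w) s && all (fun i => ~~ tst w i) t]).
  by apply: measurableI; [exact: mt|exact: IH].
apply/seteqP; split => w /=; first by rewrite -andbA => /andP.
by move=> [-> ->].
Qed.

Lemma measurable_all (I : Type) d (T : measurableType d) (tst : T -> I -> bool)
    (D : pred I) s : (forall i, D i -> measurable [set w | tst w i]) ->
  all D s -> measurable [set w | all (tst w) s].
Proof.
move=> mt Ds; have := measurable_all_tests mt Ds (isT : all D [::]).
by congr measurable; apply/seteqP; split => w; rewrite /all_tests /= andbT.
Qed.

(** Inclusion-exclusion, one failed test at a time: P(A without B) = P(A) - P(A and B) trades a
    failure for a success, until only conjunctions remain, which are the joint distribution
    functions. *)
Lemma cvg_Pr_all_tests (I : Type) d (Om : forall n : nat, measurableType (d n))
    (P : forall n, probability (Om n) R) d' (Om' : measurableType d')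
    (Q : probability Om' R) (tst : forall n, Om n -> I -> bool)
    (tst' : Om' -> I -> bool) (D : pred I) :
  (forall n i, D i -> measurable [set w | tst n w i]) ->
  (forall i, D i -> measurable [set w | tst' w i]) ->
  (forall s, all D s -> Pr (P n) [set w | all (tst n w) s] @[n --> \oo]
     --> Pr Q [set w | all (tst' w) s]) ->
  forall s t, all D s -> all D t ->
    Pr (P n) (all_tests (tst n) s t) @[n --> \oo] --> Pr Q (all_tests tst' s t).
Proof.
move=> mt mt' H s t; elim: t s => [s Ds _|i t IH s Ds /= /andP[Di Dt]].
  have E T (ts : T -> I -> bool) : all_tests ts s [::] = [set w | all (ts w) s].
    by apply/seteqP; split => w; rewrite /all_tests /= andbT.
  by rewrite E; under eq_fun do rewrite E; exact: H.
have E T (ts : T -> I -> bool) :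
    all_tests ts s (i :: t) = all_tests ts s t `\` [set w | ts w i].
  apply/seteqP; split => w; rewrite /all_tests /=; first by move/and3P => [-> /negP ni ->].
  by move=> [/andP[-> ->] /negP ->].
have E' T (ts : T -> I -> bool) :
    all_tests ts s t `&` [set w | ts w i] = all_tests ts (i :: s) t.
  apply/seteqP; split => w; rewrite /all_tests /=; first by move=> [/andP[-> ->] ->].
  by move/andP => [/andP[-> ->] ->].
rewrite E Pr_setDI; [|exact: (measurable_all_tests mt')|exact: mt'].
rewrite (_ : (fun n => _) = (fun n => Pr (P n) (all_tests (tst n) s t)
    - Pr (P n) (all_tests (tst n) (i :: s) t))); last first.
  apply/funext => n; rewrite E Pr_setDI ?E'//; last exact: mt.
  exact: (measurable_all_tests (mt n)).
rewrite E'; apply: cvgB; apply: IH => //=; exact/andP.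
Qed.

(** The count of integers [l >= 0] below [t] is the ceiling of [t]. *)
Lemma grid_count (t : R) K : 0 <= t -> t <= K%:R ->
  t <= (\sum_(l < K) (l%:R < t)%R)%:R < t + 1.
Proof.
have full n : n%:R <= t -> (\sum_(l < n) (l%:R < t)%R)%N = n.
  move=> nt; rewrite -[RHS]card_ord -sum1_card; apply: eq_bigr => l _.
  by rewrite (lt_le_trans _ nt)// ltr_nat.
move=> t0; elim: K => [|K IH] tK.
  by rewrite big_ord0; apply/andP; split => //; lra.
rewrite big_ord_recr/=; have [tK'|tK'] := leP t K%:R.
  by rewrite addn0 IH.
rewrite full ?(ltW tK')// addn1 tK/= -natr1; lra.
Qed.

Section Grid.
Context {d : measure_display} {T : measurableType d} (P : probability T R).
Context (k : nat) (Y : T -> 'I_k -> R).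
Hypotheses (mY : forall i, measurable_fun setT (Y ^~ i)) (Y0 : forall w i, 0 <= Y w i).

(** [Y] is observed only through comparisons with the thresholds l/N, so each event [code N K w = b]
    is an [all_tests] event. *)
Definition code (N K : nat) (w : T) : {ffun 'I_k * 'I_K -> bool} :=
  [ffun p : 'I_k * 'I_K => Y w p.1 <= p.2%:R / N%:R].

Lemma measurable_code N K b : measurable [set w | code N K w = b].
Proof.
rewrite (_ : [set w | _] = \bigcap_(p in [set: 'I_k * 'I_K])
    [set w | (Y w p.1 <= p.2%:R / N%:R) = b p]).
  apply: fin_bigcap_measurable => // p _.
  have m1 : measurable [set w | Y w p.1 <= p.2%:R / N%:R].
    exact: measurable_le_cst (mY p.1).
  case: (b p); first exact: m1.
  rewrite (_ : [set w | _] = ~` [set w | Y w p.1 <= p.2%:R / N%:R]).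
    exact: measurableC.
  by apply/seteqP; split => w /= => [->//|/negP/negbTE].
apply/seteqP; split => w /=; first by move=> <- p _; rewrite ffunE.
by move=> H; apply/ffunP => p; rewrite ffunE; exact: H.
Qed.

Lemma code_tests N K (b : {ffun 'I_k * 'I_K -> bool}) :
  [set w | code N K w = b] =
  all_tests (fun w p => Y w p.1 <= p.2)
    [seq (p.1, p.2%:R / N%:R) | p : 'I_k * 'I_K <- enum {: 'I_k * 'I_K} & b p]
    [seq (p.1, p.2%:R / N%:R) | p : 'I_k * 'I_K <- enum {: 'I_k * 'I_K} & ~~ b p].
Proof.
apply/seteqP; split => w; rewrite /all_tests /= !all_map.
  move=> <-; apply/andP; split; apply/allP => p; rewrite mem_filter ffunE => /andP[] //.
move=> /andP[/allP H1 /allP H2]; apply/ffunP => p; rewrite ffunE.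
have [bp|bp] := boolP (b p).
  by apply: (H1 p); rewrite mem_filter bp mem_enum.
by apply/negbTE; apply: (H2 p); rewrite mem_filter bp mem_enum.
Qed.

(** The failed thresholds are counted: by [grid_count], a coordinate of [Y] not exceeding K/N is
    rounded up to the mesh 1/N. *)
Definition grid_point (N K : nat) (b : {ffun 'I_k * 'I_K -> bool}) : 'rV[R]_k :=
  \row_i ((\sum_(l < K) ~~ b (i, l))%:R / N%:R).

Lemma grid_pointP N A w i : (0 < N)%N -> Y w i <= A%:R ->
  `|Y w i - grid_point N (code N (A * N) w) 0 i| <= N%:R^-1.
Proof.
move=> N0 YA; have N0' : (0 : R) < N%:R by rewrite ltr0n.
have := @grid_count (Y w i * N%:R) (A * N) _ _.
rewrite mulr_ge0 ?Y0// natrM ler_pM2r// => /(_ isT YA).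
have E : (\sum_(l < A * N) ~~ code N (A * N) w (i, l) =
    \sum_(l < A * N) (l%:R < Y w i * N%:R)%R)%N.
  by apply: eq_bigr => l _; rewrite ffunE/= -ltNge ltr_pdivrMr.
rewrite mxE E; set c := (X in _ <= X < _) => /andP[c1 c2].
rewrite -(ler_pM2r N0') mulVf ?gt_eqF//.
rewrite -[X in _ * X](gtr0_norm N0') -normrM mulrBl divfK ?gt_eqF// ler_norml.
by apply/andP; split; lra.
Qed.

Context (f : 'rV[R]_k -> R) (cf : continuous f) (C : R) (fC : forall v, `|f v| <= C).

Let good (A : R) := [set w | [forall i, Y w i <= A]].

Lemma measurable_good A : measurable (good A).
Proof.
rewrite (_ : good A = \bigcap_(i in [set: 'I_k]) [set w | Y w i <= A]).
  apply: fin_bigcap_measurable => // i _.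
  exact: measurable_le_cst (mY i).
apply/seteqP; split => w /=; first by move=> /forallP H i _; exact: H.
by move=> H; apply/forallP => i; exact: H.
Qed.

Lemma f_grid_point (e dlt : R) N A w : (0 < N)%N -> N%:R^-1 < dlt -> good A%:R w ->
  (forall y z : 'rV[R]_k, (forall i, 0 <= y 0 i <= A%:R) ->
    (forall i, `|y 0 i - z 0 i| < dlt) -> `|f y - f z| < e) ->
  `|f (\row_i Y w i) - f (grid_point N (code N (A * N) w))| < e.
Proof.
move=> N0 Nd /forallP gA; apply => i; first by rewrite mxE Y0 gA.
by rewrite [X in X - _]mxE; apply: le_lt_trans Nd; exact: grid_pointP.
Qed.

(** Measurability holds because [f] of the vector is the pointwise limit of [f] at its grid points,
    which are functions of a finite code; mesh and range are refined together. *)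
Lemma brv_continuous : brv (fun w => f (\row_i Y w i)).
Proof.
split; last by exists C.
apply: (@measurable_fun_cvg _ _ _ _
  (fun N w => f (grid_point N.+1 (code N.+1 (N.+1 * N.+1) w)))) => [N|w _].
  by apply: (measurable_fun_count (fun b => f (grid_point N.+1 b))) => b; exact: measurable_code.
apply/cvgrPdist_lt => e e0.
(* Only pointwise convergence is needed, so the box may depend on [w]. *)
pose A : R := \sum_i Y w i.
have YA i : Y w i <= A by rewrite /A (bigD1 i)//= lerDl sumr_ge0.
have [dlt dlt0 H] := continuous_unif_box A cf e0.
near=> N.
have AN : A <= N.+1%:R by near: N; apply: filterS (nbhs_infty_ger A) => n /le_trans; apply; rewrite ler_nat.
have Nd : N.+1%:R^-1 < dlt by near: N; exact: near_infty_natSinv_lt (PosNum dlt0).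
apply: H => i; first by rewrite mxE Y0 YA.
rewrite [X in X - _]mxE; apply: le_lt_trans Nd; apply: grid_pointP => //.
exact: le_trans AN.
Unshelve. all: by end_near. Qed.

(** The error is at most [e] where all coordinates are below [A], and at most [2 * C] elsewhere. *)
Lemma Ex_grid (e dlt : R) N A : (0 < N)%N -> N%:R^-1 < dlt ->
  (forall y z : 'rV[R]_k, (forall i, 0 <= y 0 i <= A%:R) ->
    (forall i, `|y 0 i - z 0 i| < dlt) -> `|f y - f z| < e) ->
  `|Ex P (fun w => f (\row_i Y w i)) -
    \sum_b f (grid_point N b) * Pr P [set w | code N (A * N) w = b]|
  <= e + 2 * C * (1 - Pr P (good A%:R)).
Proof.
move=> N0 Nd H.
rewrite -(Ex_fin _ (fun b => f (grid_point N b))); last by move=> b; exact: measurable_code.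
have bG : brv (fun w => f (grid_point N (code N (A * N) w))).
  by apply: (brv_fin (fun b => f (grid_point N b))) => b; exact: measurable_code.
rewrite -ExB//; last exact: brv_continuous.
have mg : measurable (~` good A%:R) by apply: measurableC; exact: measurable_good.
have C0 : 0 <= C by apply: le_trans (fC 0).
rewrite -Pr_setC; last exact: measurable_good.
rewrite -Ex_indic// -ExZ; last exact: brv_indic.
rewrite -{1}[e](Ex_cst P) -ExD; [|exact: brv_cst|by apply: brvM (brv_cst _) (brv_indic _)].
apply: Ex_norm_le.
- by apply: brvB => //; exact: brv_continuous.
- by apply: brvD (brv_cst _) (brvM (brv_cst _) (brv_indic _)).
move=> w; rewrite indicE; have [gw|gw] := pselect (good A%:R w).
  by rewrite memNset ?mulr0 ?addr0; [apply/ltW/(f_grid_point N0 Nd gw H)|apply].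
rewrite mem_set// mulr1.
have e0 : 0 <= e.
  apply: le_trans (ltW (H 0 0 _ _)) => //.
    by move=> i; rewrite mxE lexx ler0n.
  by move=> i; rewrite subrr normr0 (le_lt_trans _ Nd).
apply: le_trans (ler_normB _ _) _; have := fC (\row_i Y w i).
have := fC (grid_point N (code N (A * N) w)); lra.
Qed.

End Grid.

End WeakConvergence.

Lemma Pr_good_cvg {R : realType} {d} {T : measurableType d} (P : probability T R) k
    (Y : T -> 'I_k -> R) : (forall i, measurable_fun setT (Y ^~ i)) ->
  Pr P [set w | [forall i, Y w i <= A%:R]] @[A --> \oo] --> (1 : R).
Proof.
move=> mY; pose F (A : nat) : set T := [set w | [forall i, Y w i <= A%:R]].
have mF A : measurable (F A) by exact: measurable_good.
have FT : \bigcup_A F A = setT.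
  apply/seteqP; split => // w _.
  exists (Num.bound (\sum_i `|Y w i|)) => //=; apply/forallP => i.
  rewrite ltW// (le_lt_trans _ (archi_boundP _))//; last exact: sumr_ge0.
  by rewrite (le_trans (ler_norm _))// (bigD1 i)//= lerDl sumr_ge0.
have H : (P \o F) x @[x --> \oo] --> P (\bigcup_A F A).
  apply: nondecreasing_cvg_mu => //; first by rewrite FT.
  move=> m n mn; apply/subsetPset => w /forallP H; apply/forallP => i.
  by apply: le_trans (H i) _; rewrite ler_nat.
rewrite FT in H; have := probability_setT P => PT.
apply: (@fine_cvg _ _ _ _ (P \o F)).
by move: H; rewrite PT.
Qed.

(** The box is chosen from the limit law alone; convergence of the distribution functions at its
    corner then bounds the mass outside it under [P n]. On the box, the expectation is close to a
    finite sum of probabilities of test events, which converges term by term. *)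
Theorem weak_cvg_of_cdf {R : realType} d (Om : forall n : nat, measurableType (d n))
    (P : forall n, probability (Om n) R) d' (Om' : measurableType d')
    (Q : probability Om' R) k (Y : forall n, Om n -> 'I_k -> R) (Y' : Om' -> 'I_k -> R)
    (f : 'rV[R]_k -> R) (C : R) :
  (forall n i, measurable_fun setT (Y n ^~ i)) -> (forall n w i, 0 <= Y n w i) ->
  (forall i, measurable_fun setT (Y' ^~ i)) -> (forall w i, 0 <= Y' w i) ->
  (forall s : seq ('I_k * R), all (fun p => 0 <= p.2) s ->
     Pr (P n) [set w | all (fun p => Y n w p.1 <= p.2) s] @[n --> \oo]
     --> Pr Q [set w | all (fun p => Y' w p.1 <= p.2) s]) ->
  continuous f -> (forall v, `|f v| <= C) ->
  Ex (P n) (fun w => f (\row_i Y n w i)) @[n --> \oo] --> Ex Q (fun w => f (\row_i Y' w i)).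
Proof.
move=> mY Y0 mY' Y'0 H cf fC; apply/cvgrPdist_lt => eps eps0.
have C0 : 0 <= C by apply: le_trans (fC 0).
(* Error budget: [e + 2 * C * e] for the grid under [Q], [e + 2 * C * (2 * e)] under [P n], where
   the mass outside the box is below [2 * e], and [e] between the two grid sums. *)
have den : 0 < 3 + 6 * C by lra.
pose e := eps / (3 + 6 * C); have e0 : 0 < e by rewrite divr_gt0.
have epsE : eps = e * (3 + 6 * C) by rewrite divfK// gt_eqF.
have mte n (i : 'I_k * R) : measurable [set w | Y n w i.1 <= i.2].
  exact: measurable_le_cst (mY n i.1).
have mt' (i : 'I_k * R) : measurable [set w | Y' w i.1 <= i.2].
  exact: measurable_le_cst (mY' i.1).
have [A gA] : exists A : nat, 1 - Pr Q [set w | [forall i, Y' w i <= A%:R]] < e.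
  have /cvgrPdist_lt/(_ e e0) := Pr_good_cvg Q mY' => -[A _ /(_ A (leqnn A))] /= HA.
  by exists A; apply: le_lt_trans (ler_norm _) HA.
have [dlt dlt0 Hf] := continuous_unif_box A%:R cf e0.
have [N N0 Nd] : exists2 N, (0 < N)%N & N%:R^-1 < dlt.
  have [N _ /(_ N (leqnn N)) HN] := near_infty_natSinv_lt (PosNum dlt0).
  by exists N.+1.
have goodE T (X : T -> 'I_k -> R) : [set w | [forall i, X w i <= A%:R]] =
    [set w | all (fun p => X w p.1 <= p.2) [seq (i, A%:R) | i <- enum 'I_k]].
  apply/seteqP; split => w /=; rewrite all_map.
    by move=> /forallP XA; apply/allP => i _ /=.
  by move=> /allP XA; apply/forallP => i; apply: XA; rewrite mem_enum.
have /cvgrPdist_lt/(_ e e0) : Pr (P n) [set w | [forall i, Y n w i <= A%:R]] @[n --> \oo]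
    --> Pr Q [set w | [forall i, Y' w i <= A%:R]].
  under eq_fun do rewrite goodE; rewrite goodE; apply: H.
  by rewrite all_map; apply/allP => i _ /=; exact: ler0n.
pose S d0 (T : measurableType d0) (P0 : probability T R) (X : T -> 'I_k -> R) :=
  \sum_b f (grid_point N b) * Pr P0 [set w | code X N (A * N) w = b].
have /cvgrPdist_lt/(_ e e0) : S (d n) (Om n) (P n) (Y n) @[n --> \oo] --> S d' Om' Q Y'.
  apply: cvg_big => [|b _]; first exact: add_continuous.
  apply: cvgM; first exact: cvg_cst.
  rewrite code_tests; under eq_fun do rewrite code_tests.
  have D (q : pred ('I_k * 'I_(A * N))) :
    all (fun p : 'I_k * R => 0 <= p.2)
      [seq (p.1, p.2%:R / N%:R) | p : 'I_k * 'I_(A * N) <- enum {: 'I_k * 'I_(A * N)} & q p].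
    by rewrite all_map; apply/allP => p _ /=; rewrite divr_ge0.
  apply: (cvg_Pr_all_tests (D := fun p => 0 <= p.2)) => // n i _; exact: mte.
apply: filter_app2; near=> n => Sn gn.
have := Ex_grid (P n) (mY n) (Y0 n) cf fC N0 Nd Hf.
have := Ex_grid Q mY' Y'0 cf fC N0 Nd Hf.
rewrite -/(S d' Om' Q Y') -/(S (d n) (Om n) (P n) (Y n)).
have : 2 * C * (1 - Pr Q [set w | [forall i, Y' w i <= A%:R]]) <= 2 * C * e.
  by rewrite ler_wpM2l ?(ltW gA)// mulr_ge0.
have : 2 * C * (1 - Pr (P n) [set w | [forall i, Y n w i <= A%:R]]) <= 2 * C * (2 * e).
  rewrite ler_wpM2l ?mulr_ge0//; move: gn; rewrite ltr_norml => /andP[]; lra.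
move: Sn.
rewrite epsE !ler_norml !ltr_norml => /andP[? ?] ? ? /andP[? ?] /andP[? ?].
apply/andP; split; lra.
Unshelve. all: by end_near. Qed.

(** * Convergence of laws on the integers from Laplace transforms *)

Section HalfPowers.
Context {R : realType}.

Definition hpow (m : nat) : R := 2^-1 ^+ m.

Lemma hpow_ge0 m : 0 <= hpow m.
Proof. by rewrite exprn_ge0// invr_ge0. Qed.

Lemma hpow_le1 m : hpow m <= 1.
Proof. by rewrite exprn_ile1 ?invr_ge0// invf_le1// ler1n. Qed.

End HalfPowers.

Section LaplaceTransform.
Context {R : realType} {d : nat -> measure_display}
  {Om : forall n : nat, measurableType (d n)} (P : forall n, probability (Om n) R)
  {d' : measure_display} {Om' : measurableType d'} (Q : probability Om' R) (m : nat).
Notation state := {ffun 'I_m -> nat}.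
Context (V : forall n, Om n -> state) (V' : Om' -> state).
Hypotheses (mV : forall n (v : state), measurable [set w : Om n | V w = v])
  (mV' : forall v : state, measurable [set w | V' w = v]).
Implicit Types (F G : state -> R) (r : 'I_m -> nat).

Definition half_pow r (v : state) : R := hpow (\sum_l r l * v l)%N.

Let bounded F := exists C, forall v, `|F v| <= C.

(** Convergence is asked against every weight [half_pow r], not only for [F] itself: this makes the
    class stable under multiplication by such weights. *)
Let cvg_law F := bounded F /\
  forall r, Ex (P n) (fun w : Om n => F (V w) * half_pow r (V w)) @[n --> \oo]
    --> Ex Q (fun w => F (V' w) * half_pow r (V' w)).

Hypothesis laplace : forall r,
  Ex (P n) (fun w : Om n => half_pow r (V w)) @[n --> \oo] --> Ex Q (fun w => half_pow r (V' w)).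

Let brvF F r n : bounded F -> brv (fun w : Om n => F (V w) * half_pow r (V w)).
Proof.
move=> [C FC]; apply: (@brv_count _ _ _ _ (@V n) (fun v => F v * half_pow r v) C) => // v.
rewrite normrM (ger0_norm (hpow_ge0 _)) -[C]mulr1.
by rewrite ler_pM ?hpow_ge0 ?hpow_le1.
Qed.

Let brvF' F r : bounded F -> brv (fun w => F (V' w) * half_pow r (V' w)).
Proof.
move=> [C FC]; apply: (@brv_count _ _ _ _ V' (fun v => F v * half_pow r v) C) => // v.
rewrite normrM (ger0_norm (hpow_ge0 _)) -[C]mulr1.
by rewrite ler_pM ?hpow_ge0 ?hpow_le1.
Qed.

Let cvg_law1 : cvg_law (fun=> 1).
Proof.
split; first by exists 1 => v; rewrite normr1.
move=> r; rewrite (_ : (fun w => 1 * _) = (fun w => half_pow r (V' w))); last first.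
  by apply/funext => w; rewrite mul1r.
have E n : Ex (P n) (fun w : Om n => 1 * half_pow r (V w)) =
    Ex (P n) (fun w : Om n => half_pow r (V w)).
  by congr Ex; apply/funext => w; rewrite mul1r.
under eq_fun do rewrite E; exact: laplace.
Qed.

Let cvg_lawB F G : cvg_law F -> cvg_law G -> cvg_law (fun v => F v - G v).
Proof.
move=> [[C FC] cF] [[D GD] cG]; split.
  by exists (C + D) => v; rewrite (le_trans (ler_normB _ _))// lerD.
have bF : bounded F by exists C.
have bG : bounded G by exists D.
move=> r; rewrite (_ : (fun w => _ * half_pow r (V' w)) =
    (fun w => F (V' w) * half_pow r (V' w) - G (V' w) * half_pow r (V' w))); last first.
  by apply/funext => w; rewrite mulrBl.
rewrite ExB; [|exact: brvF'..].
have E n : Ex (P n) (fun w : Om n => (F (V w) - G (V w)) * half_pow r (V w)) =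
    Ex (P n) (fun w : Om n => F (V w) * half_pow r (V w)) -
    Ex (P n) (fun w : Om n => G (V w) * half_pow r (V w)).
  by rewrite -ExB; [congr Ex; apply/funext => w; rewrite mulrBl|exact: brvF..].
under eq_fun do rewrite E; apply: cvgB; [exact: cF|exact: cG].
Qed.

Let cvg_law_half_pow F (c : R) r : cvg_law F -> cvg_law (fun v => F v * (c * half_pow r v)).
Proof.
move=> [[C FC] cF]; have bF : bounded F by exists C.
split.
  exists (C * `|c|) => v; rewrite !normrM ler_pM ?mulr_ge0//.
  by rewrite -[X in _ <= X]mulr1 ler_pM// ger0_norm ?hpow_ge0 ?hpow_le1.
move=> r0.
have hM v : F v * (c * half_pow r v) * half_pow r0 v = 
    c * (F v * half_pow (fun l => r l + r0 l)%N v).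
  rewrite /half_pow /hpow; have -> : (\sum_l (r l + r0 l) * v l =
      \sum_l r l * v l + \sum_l r0 l * v l)%N.
    by rewrite -big_split; apply: eq_bigr => l _; rewrite mulnDl.
  by rewrite exprD; ring.
rewrite (_ : (fun w => _ * half_pow r0 (V' w)) =
    (fun w => c * (F (V' w) * half_pow (fun l => r l + r0 l)%N (V' w)))); last first.
  by apply/funext => w; rewrite hM.
rewrite ExZ; last exact: brvF'.
have E n : Ex (P n) (fun w : Om n => F (V w) * (c * half_pow r (V w)) * half_pow r0 (V w)) =
    c * Ex (P n) (fun w : Om n => F (V w) * half_pow (fun l => r l + r0 l)%N (V w)).
  by rewrite -ExZ; [congr Ex; apply/funext => w; rewrite hM|exact: brvF].
by under eq_fun do rewrite E; apply: cvgM; [exact: cvg_cst|exact: cF].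
Qed.

(** A uniform error on the state space survives expectation under [Q] and under every [P n] alike,
    so the choice of [G] does not depend on n. *)
Let cvg_law_unif F : (forall e, 0 < e -> exists2 G, cvg_law G & forall v, `|F v - G v| <= e) ->
  cvg_law F.
Proof.
move=> H.
have bF : bounded F.
  have [G [[C GC] _] FG] := H 1 ltr01.
  exists (1 + C) => v; rewrite -(subrK (G v) (F v)) (le_trans (ler_normD _ _))//.
  by rewrite lerD.
split => // r; apply/cvgrPdist_lt => e e0.
have e30 : 0 < e / 3 by rewrite divr_gt0.
have [G [bG cG] FG] := H _ e30.
have FG1 v : `|F v * half_pow r v - G v * half_pow r v| <= e / 3.
  rewrite -mulrBl normrM -[e / 3]mulr1 ler_pM// ger0_norm ?hpow_le1 ?hpow_ge0//.
have /cvgrPdist_lt/(_ _ e30) := cG r; apply: filterS => n Hn.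
have H1 : `|Ex Q (fun w => F (V' w) * half_pow r (V' w)) -
    Ex Q (fun w => G (V' w) * half_pow r (V' w))| <= e / 3.
  rewrite -ExB; [|exact: brvF'..]; rewrite -[X in _ <= X](Ex_cst Q).
  by apply: Ex_norm_le; [apply: brvB; exact: brvF'|exact: brv_cst|].
have H2 : `|Ex (P n) (fun w : Om n => F (V w) * half_pow r (V w)) -
    Ex (P n) (fun w : Om n => G (V w) * half_pow r (V w))| <= e / 3.
  rewrite -ExB; [|exact: brvF..]; rewrite -[X in _ <= X](Ex_cst (P n)).
  by apply: Ex_norm_le; [apply: brvB; exact: brvF|exact: brv_cst|].
move: H1 H2 Hn; rewrite !ler_norml !ltr_norml => /andP[? ?] /andP[? ?] /andP[? ?].
by apply/andP; split; lra.
Qed.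

Let cvg_law_sum F (H : nat -> state -> R) a : cvg_law F -> (forall w, (w < a)%N -> cvg_law (H w)) ->
  cvg_law (fun v => F v - \sum_(w < a) H w v).
Proof.
move=> cF; elim: a => [_|a IH cH].
  by rewrite (_ : (fun v => _) = F)//; apply/funext => v; rewrite big_ord0 subr0.
rewrite (_ : (fun v => _) = (fun v => (F v - \sum_(w < a) H w v) - H a v)); last first.
  by apply/funext => v; rewrite big_ord_recr/= opprD addrA.
apply: cvg_lawB; last exact: cH.
by apply: IH => w wa; apply: cH; rewrite ltnS ltnW.
Qed.

(* The indicator of [v l = a] is the uniform limit of
   [(2 ^ a * 2 ^ (- v l)) ^ N * (1 - \sum_(w < a) [v l = w])] as N goes to infinity. *)
Let cvg_law_eq F l a : cvg_law F -> cvg_law (fun v => F v * (v l == a)%:R).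
Proof.
elim/ltn_ind: a F => a IH F cF; have [[C FC] _] := cF.
have C0 : 0 <= C by apply: le_trans (FC [ffun=> 0%N]).
apply: cvg_law_unif => e e0.
have [N HN] : exists N, C * 2^-1 ^+ N <= e.
  have Ce : 0 < e / (C + 1) by rewrite divr_gt0// ltr_wpDl.
  have [N _ /(_ N (leqnn N)) /= HN] := near_infty_natSinv_expn_lt (PosNum Ce).
  exists N; move: HN; rewrite div1r -exprVn /= ltr_pdivlMr ?ltr_wpDl// => HN.
  apply: le_trans (ltW HN); rewrite mulrC ler_wpM2l ?exprn_ge0 ?invr_ge0//; lra.
exists (fun v => (F v - \sum_(w < a) F v * (v l == w)%:R) *
    (2 ^+ (a * N) * half_pow (fun l' => (l' == l) * N)%N v)).
  apply: cvg_law_half_pow; apply: (cvg_law_sum (H := fun w v => F v * (v l == w)%:R)) => // w wa.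
  exact: IH.
move=> v; rewrite -mulr_sumr; set s := \sum_(w < a) _.
rewrite /half_pow /hpow (bigD1 l)//= eqxx mul1n big1 ?addn0; last first.
  by move=> l' /negbTE ->; rewrite mul0n.
have sE : s = (v l < a)%:R.
  rewrite /s; have [va|va] := ltnP (v l) a.
    rewrite (bigD1 (Ordinal va))//= eqxx big1 ?addr0// => w /eqP wv.
    by case: eqP => // E; case: wv; apply: val_inj.
  by rewrite big1// => w _; rewrite gtn_eqF// (leq_trans (ltn_ord w)).
(* Below [a] the bracket vanishes; above [a] the power is at most 2^(-N); at [a] both factors are
   exactly 1. *)
rewrite sE; case: (ltngtP (v l) a) => va.
- by rewrite mulr1 subrr mul0r mulr0 subr0 normr0 ltW.
- rewrite mulr0 subr0 sub0r normrN normrM; apply: le_trans HN.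
  rewrite ler_pM// ger0_norm; last first.
    by rewrite mulr_ge0 ?exprn_ge0 ?invr_ge0.
  have -> : (N * v l = a * N + (v l - a) * N)%N by rewrite -mulnDl subnKC 1?mulnC// ltnW.
  rewrite exprD mulrA -exprMn mulfV// expr1n mul1r.
  rewrite ler_wiXn2l ?invr_ge0 ?invf_le1 ?ler1n//.
  by rewrite leq_pmull// subn_gt0.
- rewrite va mulr0 subr0 mulr1 mulnC -exprMn mulfV// expr1n mulr1 subrr normr0.
  exact: ltW.
Qed.

(** The complement of [b <= v l] consists of finitely many values, so no infinite sum of masses
    occurs. *)
Let cvg_law_ge F l b : cvg_law F -> cvg_law (fun v => F v * (b <= v l)%N%:R).
Proof.
move=> cF; rewrite (_ : (fun v => _) = (fun v => F v - \sum_(w < b) F v * (v l == w)%:R)).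
  apply: (cvg_law_sum (H := fun w v => F v * (v l == w)%:R)) => // w _.
  exact: cvg_law_eq.
apply/funext => v; rewrite -mulr_sumr -[X in X - _]mulr1 -mulrBr; congr (_ * _).
have [bv|vb] := leqP b (v l).
  by rewrite big1 ?subr0// => w _; rewrite gtn_eqF// (leq_trans (ltn_ord w)).
rewrite (bigD1 (Ordinal vb))//= eqxx big1 ?addr0 ?subrr// => w /eqP wv.
by case: eqP => // E; case: wv; apply: val_inj.
Qed.

(** The indicators are multiplied in one coordinate at a time, and the remaining weight is removed
    by taking [r = 0]. *)
Theorem cvg_Pr_of_laplace (b : 'I_m -> nat) :
  Pr (P n) [set w : Om n | [forall l, b l <= V w l]%N] @[n --> \oo]
  --> Pr Q [set w | [forall l, b l <= V' w l]%N].
Proof.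
have cvg_prod (s : seq 'I_m) : cvg_law (fun v : state => (all (fun l => b l <= v l)%N s)%:R).
  elim: s => [|l s IH]; first exact: cvg_law1.
  rewrite (_ : (fun v : state => _) = (fun v : state => (all (fun l => b l <= v l)%N s)%:R * (b l <= v l)%N%:R)).
    exact: cvg_law_ge.
  by apply/funext => v /=; rewrite -natrM mulnb andbC.
have [_ /(_ (fun=> 0%N))] := cvg_prod (enum 'I_m).
have E dd (T : measurableType dd) (P0 : probability T R) (X : T -> state) :
    (forall v, measurable [set w | X w = v]) ->
    Ex P0 (fun w => (all (fun l => b l <= X w l)%N (enum 'I_m))%:R * half_pow (fun=> 0%N) (X w)) =
    Pr P0 [set w | [forall l, b l <= X w l]%N].
  move=> mX; rewrite -Ex_indic.
    congr Ex; apply/funext => w; rewrite /half_pow /hpow big1 ?expr0 ?mulr1// indicE.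
    congr ((nat_of_bool _)%:R); apply/allP/idP => [H|/set_mem/= /forallP H l _]; last exact: H.
    by apply: mem_set => /=; apply/forallP => l; apply: H; rewrite mem_enum.
  exact: (measurable_preimage_count (fun v : state => [forall l, b l <= v l]%N)).
by rewrite E//; under eq_fun do rewrite E//.
Qed.

End LaplaceTransform.

(** * Hitting times of counting processes *)

Section HittingTimes.
Context {R : realType}.

Definition counting_path (c : R -> nat) :=
  (forall s t, 0 <= s -> s <= t -> (c s <= c t)%N) /\
  (forall t, 0 <= t -> exists2 e : R, 0 < e & forall s, t <= s -> s < t + e -> c s = c t).

Lemma kth_point_ge0 (c : R -> nat) k : 0 <= kth_point c k.
Proof.
rewrite /kth_point; set A := [set t | _].
have [->|A0] := eqVneq A set0; first by rewrite inf0.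
by apply: lb_le_inf; [exact/set0P|move=> t []].
Qed.

(** Right-continuity makes the infimum attained. The assumption that level [k] is reached excludes
    the default value 0 of the infimum. *)
Lemma kth_point_le (c : R -> nat) k t : counting_path c ->
  (exists2 s, 0 <= s & (k <= c s)%N) -> 0 <= t -> (kth_point c k <= t) = (k <= c t)%N.
Proof.
move=> [mono rc] [s0 s00 ks0] t0; rewrite /kth_point; set A := [set t | _].
have hA : has_inf A by split; [exists s0|exists 0 => s []].
apply/idP/idP => [At|kt]; last by apply: ge_inf => //; exact: hA.2.
have [e e0 He] := rc t t0.
have [s [s0' ks] st] : exists2 s, A s & s < t + e.
  have [|s As st] := @inf_adherent _ A (t + e - inf A) _ hA.
      by rewrite subr_gt0 (le_lt_trans At)// ltrDl.
    by exists s => //; rewrite subrKC in st.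
have [st'|ts] := leP s t; first exact: leq_trans ks (mono _ _ s0' st').
by rewrite -(He s (ltW ts) st).
Qed.

Context {d : measure_display} {T : measurableType d} (P : probability T R).

Definition counting_process (c : T -> R -> nat) :=
  (forall w, counting_path (c w)) /\
  (forall t a, 0 <= t -> measurable [set w | c w t = a]).

(** The event on which [kth_point] takes its default value 0 and so ceases to be a hitting time. *)
Definition never (c : T -> R -> nat) k := [set w | forall t, 0 <= t -> (c w t < k)%N].

Variables (c : T -> R -> nat).
Hypothesis (cp : counting_process c).

Lemma measurable_counting (S : set nat) t : 0 <= t -> measurable [set w | S (c w t)].
Proof.
by move=> t0; apply: (measurable_preimage_count (xi := c ^~ t)) => a; exact: cp.2.
Qed.

Lemma measurable_never k : measurable (never c k).
Proof.
(* By monotonicity integer times suffice, which makes the intersection countable. *)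
have -> : never c k = \bigcap_(m : nat) [set w | (c w m%:R < k)%N].
  apply/seteqP; split => w H /=; first by move=> m _; exact: H.
  move=> t t0; apply: leq_ltn_trans (H (Num.bound t) I).
  by apply: (cp.1 w).1 => //; apply/ltW/archi_boundP.
by apply: bigcapT_measurable => m; apply: (measurable_counting (fun a => a < k)%N).
Qed.

Lemma Pr_never k :
  (forall e : R, 0 < e -> exists2 t, 0 <= t & Pr P [set w | (c w t < k)%N] <= e) ->
  Pr P (never c k) = 0.
Proof.
move=> H; apply/eqP; rewrite eq_le Pr_ge0 andbT; apply/ler_addgt0Pl => e e0.
have [t t0 He] := H e e0; rewrite addr0; apply: le_trans He.
apply: Pr_le; [exact: measurable_never|exact: (measurable_counting (fun a => a < k)%N)|].
by move=> w /(_ t t0).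
Qed.

Lemma kth_pointP w k t : ~ never c k w -> 0 <= t -> (kth_point (c w) k <= t) = (k <= c w t)%N.
Proof.
move=> nw t0; apply: kth_point_le => //; first exact: cp.1.
apply: contrapT => H; apply: nw => s s0; rewrite ltnNge; apply/negP => ks.
by apply: H; exists s.
Qed.

Lemma measurable_kth_point k : measurable_fun setT (fun w => kth_point (c w) k).
Proof.
apply: (measurability _ (RGenOInfty.measurableE R)) => // _ [_ [x ->] <-].
rewrite setTI (_ : _ @^-1` _ = ~` [set w | kth_point (c w) k <= x]); last first.
  by apply/seteqP; split => w /=; rewrite in_itv/= andbT ltNge => /negP.
apply: measurableC; have [x0|x0] := ltP x 0.
  rewrite (_ : [set w | _] = set0)//; apply/seteqP; split => w //= wx.
  by have := lt_le_trans (le_lt_trans wx x0) (kth_point_ge0 (c w) k); rewrite ltxx.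
(* The paths in [never c k] belong here because their default value 0 is at most [x]. *)
rewrite (_ : [set w | _] = never c k `|` [set w | (k <= c w x)%N]).
  apply: measurableU; first exact: measurable_never.
  exact: (measurable_counting (fun a => k <= a)%N).
apply/seteqP; split => w /=.
  by have [|nw] := pselect (never c k w); [left|right; rewrite -kth_pointP].
case; last first.
  move=> kc; rewrite kth_point_le//; first exact: cp.1.
  by exists x.
move=> nw; rewrite /kth_point (_ : [set t | _] = set0) ?inf0//.
apply/seteqP; split => t //= [t0]; by rewrite leqNgt (nw t t0).
Qed.

(** One null event serves all levels: a path that misses a level [k <= K] also misses [K]. *)
Lemma Pr_kth_point_tests (K : nat) (s : seq (nat * R)) :
  all (fun p => (p.1 <= K)%N && (0 <= p.2)) s -> Pr P (never c K) = 0 ->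
  Pr P [set w | all (fun p => kth_point (c w) p.1 <= p.2) s] =
  Pr P [set w | all (fun p => p.1 <= c w p.2)%N s].
Proof.
move=> sK nK.
apply: (@Pr_eq_ae _ _ _ _ _ _ (never c K)) => //.
- apply: (measurable_all (D := fun p => (p.1 <= K)%N && (0 <= p.2))) => // p _.
  exact/measurable_le_cst/measurable_kth_point.
- apply: (measurable_all (D := fun p => (p.1 <= K)%N && (0 <= p.2))) => // p /andP[_ p0].
  exact: (measurable_counting (fun a => p.1 <= a)%N).
- exact: measurable_never.
move=> w nw /=; have E p : p \in s -> (kth_point (c w) p.1 <= p.2) = (p.1 <= c w p.2)%N.
  move=> /(allP sK)/andP[pK p0]; apply: kth_pointP => // nev; apply: nw => t t0.
  exact: leq_trans (nev t t0) pK.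
by rewrite (eq_in_all E).
Qed.

End HittingTimes.

(** * Lehmer codes and Mallows marginals *)

Section LehmerCode.
Context (n : nat).
Implicit Types (s : 'S_n) (j : 'I_n).

Lemma InvE s : Defs.Inv s = #|[pred p : 'I_n * 'I_n | (p.1 < p.2)%N && (s p.2 < s p.1)%N]|.
Proof. by apply: eq_card => p; apply/idP/idP => [/set_mem|H] //; exact: mem_set. Qed.

Lemma InvjE s j : Invj s j = #|[set i : 'I_n | (i < j)%N && (s j < s i)%N]%SET|.
Proof.
apply: eq_card => p; rewrite inE.
by apply/idP/idP => [/set_mem|H] //; exact: mem_set.
Qed.

Lemma Inv_sum s : Defs.Inv s = (\sum_j Invj s j)%N.
Proof.
rewrite InvE -sum1_card.
rewrite -(pair_big_dep xpredT (fun i j : 'I_n => (i < j)%N && (s j < s i)%N) (fun _ _ => 1%N)) /=.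
rewrite (exchange_big_dep xpredT)//=; apply: eq_bigr => j _.
by rewrite InvjE -sum1dep_card.
Qed.

Lemma Invj_le s j : (Invj s j <= j)%N.
Proof.
apply: (@leq_trans #|[set i : 'I_n | (i < j)%N]%SET|).
  by rewrite InvjE; apply: subset_leq_card; apply/fintype.subsetP => i; rewrite !inE => /andP[].
rewrite -sum1dep_card.
by rewrite -(big_ord_widen n (fun=> 1%N)) ?sum1_card ?card_ord// ltnW.
Qed.

(* If [s] and [s'] agree above [j], both map the positions up to [j] onto the
   same set, in which [s j] has exactly [Invj s j] larger elements. *)
Lemma Invj_inj s s' : Invj s =1 Invj s' -> s = s'.
Proof.
(* The induction runs from the last position downwards. *)
move=> E; suff H : forall m j, (n - j <= m)%N -> s j = s' j.
  by apply/permP => j; apply: (H n); exact: leq_subr.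
elim=> [|m IH] j jm; first by have := ltn_ord j; lia.
have agree (i : 'I_n) : (j < i)%N -> s i = s' i by move=> ji; apply: IH; have := ltn_ord i; lia.
(* Inversions are counted by values instead of positions. A value above [t' j] that [t'] takes
   before [j] is also taken before [j] by [t] and exceeds [t j]; the value [t' j] itself is one more
   for [t]. *)
have noteq (t t' : 'S_n) : (forall i : 'I_n, (j < i)%N -> t i = t' i) ->
    (t j < t' j)%N -> (Invj t' j < Invj t j)%N.
  move=> tt' lt; rewrite !InvjE.
  have imE (u : 'S_n) : #|[set i : 'I_n | (i < j)%N && (u j < u i)%N]%SET| =
      #|[set a : 'I_n | (u^-1 a < j)%N && (u j < a)%N]%SET|%g.
    rewrite -(card_imset _ (@perm_inj _ u)); congr #|pred_of_set _|.
    apply/finset.setP => a; apply/imsetP/idP => [[i + ->]|]; rewrite !inE ?permK// => H.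
    by exists (u^-1 a)%g; rewrite ?inE permKV.
  rewrite !imE; apply: proper_card; apply/fintype.properP; split.
    apply/fintype.subsetP => a; rewrite !inE => /andP[a1 a2]; rewrite (ltn_trans lt a2) andbT.
    have : ((t^-1)%g a <= j)%N.
      rewrite leqNgt; apply/negP => ja; have := tt' _ ja; rewrite permKV => Ea.
      by move: a1; rewrite Ea permK ltnNge ltnW.
    rewrite leq_eqVlt => /orP[/eqP/val_inj Ea|//].
    by move: a2; rewrite -Ea permKV in lt *; lia.
  exists (t' j); rewrite !inE ?ltnn ?andbF// lt andbT.
  have : ((t^-1)%g (t' j) <= j)%N.
    rewrite leqNgt; apply/negP => ja; have := tt' _ ja; rewrite permKV => /perm_inj Ea.
    by move: ja; rewrite -Ea ltnn.
  rewrite leq_eqVlt => /orP[/eqP/val_inj Ea|//].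
  by move: lt; rewrite -{1}Ea permKV ltnn.
apply: ord_inj; apply/eqP; rewrite eqn_leq; apply/andP; split; rewrite leqNgt; apply/negP => lt.
  by have := noteq s' s (fun i ji => esym (agree i ji)) lt; rewrite E ltnn.
by have := noteq s s' agree lt; rewrite E ltnn.
Qed.

Definition lehmer s : {ffun 'I_n -> 'I_n} :=
  [ffun j => Ordinal (leq_ltn_trans (Invj_le s j) (ltn_ord j))].

Lemma lehmer_inj : injective lehmer.
Proof.
by move=> s s' /ffunP E; apply: Invj_inj => j; have := congr1 val (E j); rewrite !ffunE.
Qed.

(** The Lehmer code is injective into the box of the [f] with [f j <= j], which has n! elements, so
    it is onto; the sum over the box then distributes into a product. *)
Lemma sum_prod_Invj (R : comNzRingType) (g : 'I_n -> nat -> R) :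
  \sum_(s : 'S_n) \prod_j g j (Invj s j) = \prod_(j < n) \sum_(l < j.+1) g j l.
Proof.
have -> : \prod_(j < n) \sum_(l < j.+1) g j l = \prod_(j < n) \sum_(c : 'I_n | (c <= j)%N) g j c.
  by apply: eq_bigr => j _; rewrite (big_ord_widen n (g j)).
have imE : lehmer @: [set: 'S_n]%SET = [set f in family (fun j : 'I_n => [pred c : 'I_n | (c <= j)%N])]%SET.
  apply/eqP; rewrite eqEcard; apply/andP; split.
    apply/fintype.subsetP => f /imsetP[s _ ->]; rewrite inE; apply/familyP => j.
    by rewrite inE ffunE /=; exact: Invj_le.
  rewrite card_imset; last exact: lehmer_inj.
  rewrite cardsT card_Sn cardsE card_family foldrE big_map.
  rewrite fact_prod big_add1 /= big_mkord big_enum /=; apply/eq_leq/eq_bigr => j _.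
  transitivity (\sum_(i < n | (i < j.+1)%N) 1)%N; first by rewrite -sum1_card; apply: eq_bigl.
  by rewrite -(big_ord_widen n (fun=> 1%N)) ?sum1_card ?card_ord.
rewrite bigA_distr_big_dep; transitivity (\sum_(f in lehmer @: [set: 'S_n]%SET) \prod_j g j (f j)).
  rewrite big_imset; last by move=> s s' _ _; exact: lehmer_inj.
  apply: eq_big => [s|s _]; first by rewrite inE.
  by apply: eq_bigr => j _; rewrite ffunE.
by rewrite imE; apply: eq_bigl => f; rewrite inE.
Qed.

End LehmerCode.

(** * Products of n factors close to 1 - c/n *)

Section ProductLimit.
Context {R : realType}.

Lemma expRN_bounds (h : R) : 0 <= h -> 1 - h <= expR (- h) <= 1 - h + h ^+ 2.
Proof.
move=> h0; apply/andP; split; first by have := expR_ge1Dx (- h).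
have H := expR_ge1Dx h; have h1 : 0 < 1 + h by lra.
rewrite expRN -[X in X^-1 <= _]mulr1 ; apply: (@le_trans _ _ (1 + h)^-1).
  by rewrite mulr1 lef_pV2 ?posrE ?expR_gt0.
(* (1 + h)(1 - h + h^2) = 1 + h^3. *)
rewrite -[_^-1]mul1r ler_pdivrMr//; have := exprn_ge0 3 h0; lra.
Qed.

(** Factors are exchanged one at a time; the others, lying in [0, 1], do not enlarge the
    difference. *)
Lemma dist_prod_le n (a b : 'I_n -> R) : (forall j, 0 <= a j <= 1) -> (forall j, 0 <= b j <= 1) ->
  `|\prod_j a j - \prod_j b j| <= \sum_j `|a j - b j|.
Proof.
elim: n a b => [|n IH] a b Ha Hb; first by rewrite !big_ord0 subrr normr0.
rewrite !big_ord_recl.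
set A := \prod_(i < n) a _; set B := \prod_(i < n) b _.
have -> : a ord0 * A - b ord0 * B = (a ord0 - b ord0) * A + b ord0 * (A - B) by ring.
have /andP[a0 a1] := Ha ord0; have /andP[b0 b1] := Hb ord0.
have A0 : 0 <= A by apply: prodr_ge0 => i _; case/andP: (Ha (lift ord0 i)).
have A1 : A <= 1 by apply: prodr_ile1 => i _; exact: Ha.
apply: le_trans (ler_normD _ _) _; rewrite !normrM (ger0_norm A0) (ger0_norm b0).
apply: lerD; first by rewrite ler_piMr.
by apply: le_trans (IH _ _ _ _) => // ; rewrite ler_piMl.
Qed.

(* Le Cam: compare the product with [expR (- c / n) ^+ n] factor by factor. *)
Lemma cvg_prod_expR (a : forall n, 'I_n -> R) (c K : R) : 0 <= c -> 0 <= K ->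
  (forall n j, 0 <= a n j <= 1) ->
  (forall n (j : 'I_n), `|a n j - (1 - c / n%:R)| <= K / n%:R) ->
  (forall n (j : 'I_n), (0 < j)%N -> `|a n j - (1 - c / n%:R)| <= K / n%:R ^+ 2) ->
  \prod_j a n j @[n --> \oo] --> expR (- c).
Proof.
move=> c0 K0 a01 aK aK2.
(* The factor [j = 0] costs at most K/n + c^2/n, and the others together at most n(K/n^2 + c^2/n^2);
   the two add up to this bound. The terms in c come from replacing 1 - c/n by exp(-c/n). *)
have bound n : (0 < n)%N -> `|expR (- c) - \prod_j a n j| <= 2 * (K + c ^+ 2) / n%:R.
  case: n => // n _; set N : R := n.+1%:R; have N0 : 0 < N by rewrite ltr0n.
  have cN0 : 0 <= c / N by rewrite divr_ge0// ltW.
  have /andP[e1 e2] := expRN_bounds cN0.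
  have -> : expR (- c) = \prod_(j < n.+1) expR (- (c / N)).
    rewrite prodr_const card_ord -expRM_natr; congr expR.
    by rewrite -/N mulNr divfK// gt_eqF.
  rewrite distrC; apply: le_trans (dist_prod_le (a01 _) _) _.
    by move=> j; rewrite expR_ge0/= -expR0 ler_expR oppr_le0.
  have dE (j : 'I_n.+1) (e : R) : `|a n.+1 j - (1 - c / N)| <= e ->
      `|a n.+1 j - expR (- (c / N))| <= e + (c / N) ^+ 2.
    move: (c / N) (expR _) e1 e2 => h b e1 e2.
    rewrite !ler_norml => /andP[? ?]; apply/andP; split; lra.
  rewrite big_ord_recl; apply: (@le_trans _ _ ((K / N + (c / N) ^+ 2) +
      \sum_(j < n) (K / N ^+ 2 + (c / N) ^+ 2))).
    by apply: lerD; [exact/dE/aK|apply: ler_sum => j _; exact/dE/aK2].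
  rewrite sumr_const card_ord -[_ *+ n]mulr_natl.
  have H2 : n%:R * (K / N ^+ 2 + (c / N) ^+ 2) <= N * (K / N ^+ 2 + (c / N) ^+ 2).
    rewrite ler_wpM2r ?ler_nat// addr_ge0 ?sqr_ge0// divr_ge0// exprn_ge0// ltW.
  have H3 : (c / N) ^+ 2 <= N * (c / N) ^+ 2.
    by rewrite ler_peMl ?sqr_ge0// ler1n.
  have H4 : N * (K / N ^+ 2 + (c / N) ^+ 2) = (K + c ^+ 2) / N.
    by field; rewrite gt_eqF.
  have H5 : N * (c / N) ^+ 2 = c ^+ 2 / N by field; rewrite gt_eqF.
  have H6 : 2 * (K + c ^+ 2) / N = K / N + c ^+ 2 / N + (K + c ^+ 2) / N by field; rewrite gt_eqF.
  rewrite H6; move: H2 H3; rewrite H4 H5.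
  move: (K / N) (c ^+ 2 / N) ((K + c ^+ 2) / N) ((c / N) ^+ 2) (n%:R * _) => *; lra.
apply/cvgrPdist_le => e e0.
have [m _ Hm] := nbhs_infty_ger (2 * (K + c ^+ 2) / e).
exists m.+1 => // n /= mn; have n0 : (0 < n)%N by apply: leq_trans mn.
apply: le_trans (bound n n0) _; rewrite ler_pdivrMr ?ltr0n// [X in _ <= X]mulrC -ler_pdivrMr//.
by apply: Hm => /=; rewrite ltnW.
Qed.

End ProductLimit.

(** * One-time laws of a Mallows process *)

Section MallowsMarginals.
Context {R : realType}.
Implicit Types (q z : R).

(** The q-analogue of j + 1, which normalises the geometric law truncated to {0, ..., j};
    [mallows_Z] is the product of these. *)
Definition qnum (j : nat) q : R := \sum_(l < j.+1) q ^+ l.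

Lemma qnum_ge1 j q : 0 <= q -> 1 <= qnum j q.
Proof.
move=> q0; rewrite /qnum big_ord_recl expr0 lerDl.
by apply: sumr_ge0 => l _; exact: exprn_ge0.
Qed.

Lemma qnum_gt0 j q : 0 <= q -> 0 < qnum j q.
Proof. by move=> q0; rewrite (lt_le_trans ltr01)// qnum_ge1. Qed.

(** The lower bound follows from (1 - q) [qnum j q] = 1 - q^(j+1) <= 1. The upper one follows from
    [1 + q <= qnum j q], where [0 < j] enters, and (1 + q)(1 - q + q^2) = 1 + q^3. *)
Lemma qnumV_bounds j q : 0 <= q -> (0 < j)%N -> 1 - q <= (qnum j q)^-1 <= 1 - q + q ^+ 2.
Proof.
move=> q0 j0; have s0 := qnum_gt0 j q0; apply/andP; split.
  rewrite -[_^-1]mul1r ler_pdivlMr//; have := subrX1 q j.+1; rewrite -/(qnum j q).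
  have := exprn_ge0 j.+1 q0; lra.
have H : 1 + q <= qnum j q.
  case: j j0 {s0} => // j _; rewrite /qnum 2!big_ord_recl expr0 /= expr1 addrA lerDl.
  by apply: sumr_ge0 => l _; exact: exprn_ge0.
have q1 : 0 < 1 + q by lra.
apply: (@le_trans _ _ (1 + q)^-1); first by rewrite lef_pV2 ?posrE.
rewrite -[_^-1]mul1r ler_pdivrMr//; have := exprn_ge0 3 q0; lra.
Qed.

Lemma sum_mallows_prod n (h : 'I_n -> nat -> R) q :
  \sum_(s : 'S_n) (\prod_j h j (Invj s j)) * mallows q s =
  (\prod_(j < n) \sum_(l < j.+1) h j l * q ^+ l) / mallows_Z n q.
Proof.
rewrite -(sum_prod_Invj (fun j l => h j l * q ^+ l)) mulr_suml; apply: eq_bigr => s _.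
rewrite /mallows mulrA Inv_sum; congr (_ / _).
by rewrite expr_sum -big_split.
Qed.

(** The truncated geometric marginal: with test functions equal to 1 at every [j] other than [j0],
    all the other factors cancel against [mallows_Z]. *)
Lemma sum_mallows_Invj n (j0 : 'I_n) (h : nat -> R) q : 0 <= q ->
  \sum_(s : 'S_n) h (Invj s j0) * mallows q s = (\sum_(l < j0.+1) h l * q ^+ l) / qnum j0 q.
Proof.
move=> q0; pose g (j : 'I_n) l := if j == j0 then h l else 1.
transitivity (\sum_(s : 'S_n) (\prod_j g j (Invj s j)) * mallows q s).
  apply: eq_bigr => s _; congr (_ * _); rewrite (bigD1 j0)//= /g eqxx big1 ?mulr1// => j /negbTE.
  by move=> ->.
rewrite sum_mallows_prod /mallows_Z (bigD1 j0)//= [X in _ / X](bigD1 j0)//=.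
rewrite (eq_bigr (fun j : 'I_n => qnum j q)); last first.
  move=> j /negbTE jj; rewrite /qnum; apply: eq_bigr => l _; by rewrite /g jj mul1r.
rewrite -/(qnum j0 q) [X in _ / (_ * X)](eq_bigr (fun j : 'I_n => qnum j q))//.
rewrite -mulf_div divff ?mulr1; first by rewrite /g eqxx.
by apply/prodf_neq0 => j _; rewrite gt_eqF// qnum_gt0.
Qed.

Context {d : measure_display} {T : measurableType d} (P : probability T R).
Context (n : nat) (M : T -> R -> 'S_n).
Hypothesis mp : mallows_process P M.

Lemma measurable_mallows t s : 0 <= t -> measurable [set w | M w t = s].
Proof. by move=> t0; apply: mp.2.1. Qed.

Lemma Ex_mallows (g : 'S_n -> R) t : 0 <= t ->
  Ex P (fun w => g (M w t)) = \sum_s g s * mallows t s.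
Proof.
move=> t0; rewrite (Ex_fin P g); last by move=> s; exact: measurable_mallows.
by apply: eq_bigr => s _; rewrite /Pr mp.2.2.
Qed.

Lemma Ex_mallows_Inv z t : 0 <= z -> 0 <= t ->
  Ex P (fun w => z ^+ Defs.Inv (M w t)) = (\prod_(j < n) qnum j (z * t)) / \prod_(j < n) qnum j t.
Proof.
move=> z0 t0; rewrite (Ex_mallows (fun s => z ^+ Defs.Inv s))//.
transitivity (\sum_(s : 'S_n) (\prod_j z ^+ Invj s j) * mallows t s).
  by apply: eq_bigr => s _; rewrite Inv_sum expr_sum.
rewrite (sum_mallows_prod (fun _ l => z ^+ l)); congr (_ / _).
by apply: eq_bigr => j _; apply: eq_bigr => l _; rewrite exprMn.
Qed.

Lemma measurable_mallows_event (S : set 'S_n) t : 0 <= t -> measurable [set w | S (M w t)].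
Proof.
move=> t0; apply: (measurable_preimage_count (xi := M ^~ t)) => s.
exact: measurable_mallows.
Qed.

Lemma Pr_mallows (S : pred 'S_n) t : 0 <= t ->
  Pr P [set w | S (M w t)] = \sum_s (S s)%:R * mallows t s.
Proof.
move=> t0; rewrite -Ex_indic; last exact: (measurable_mallows_event S).
rewrite -(Ex_mallows (fun s => (S s)%:R))//; congr Ex; apply/funext => w.
by rewrite indicE; congr ((nat_of_bool _)%:R); apply/idP/idP => [/set_mem|H]//; apply: mem_set.
Qed.

(** The probability equals 1 - 1 / [qnum j t], to which [qnumV_bounds] applies. *)
Lemma Pr_Invj_ge1 (j : 'I_n) t : 0 <= t -> (0 < j)%N ->
  t - t ^+ 2 <= Pr P [set w | (0 < Invj (M w t) j)%N] <= t.
Proof.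
move=> t0 j0; rewrite (Pr_mallows (fun s => 0 < Invj s j)%N)//.
rewrite (sum_mallows_Invj j (fun l => (0 < l)%N%:R))//.
have -> : \sum_(l < j.+1) (0 < l)%N%:R * t ^+ l = qnum j t - 1.
  rewrite /qnum !big_ord_recl /= mul0r add0r expr0 addrC addKr.
  by apply: eq_bigr => l _; rewrite mul1r.
rewrite mulrBl divff ?mul1r; last by rewrite gt_eqF// qnum_gt0.
have := qnumV_bounds t0 j0; lra.
Qed.

Lemma Pr_Invj_ge2 (j : 'I_n) t : 0 <= t ->
  Pr P [set w | (1 < Invj (M w t) j)%N] <= t ^+ 2.
Proof.
move=> t0; rewrite (Pr_mallows (fun s => 1 < Invj s j)%N)//.
rewrite (sum_mallows_Invj j (fun l => (1 < l)%N%:R))// ler_pdivrMr ?qnum_gt0//.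
case: (nat_of_ord j) => [|[|m]].
- by rewrite big_ord_recl big_ord0 mul0r addr0 mulr_ge0 ?exprn_ge0// ltW// qnum_gt0.
- by rewrite !big_ord_recl big_ord0 !mul0r !addr0 mulr_ge0 ?exprn_ge0// ltW// qnum_gt0.
(* Once t^2 is factored out, the numerator is [qnum] without its last two terms. *)
rewrite /qnum 2!big_ord_recl /= !mul0r !add0r [X in _ <= _ * X]big_ord_recr
  [X in _ <= _ * (X + _)]big_ord_recr /= !mulrDr mulr_sumr -addrA; apply: ler_wpDr.
  by rewrite addr_ge0// mulr_ge0// exprn_ge0.
by apply: ler_sum => l _; rewrite mul1r -exprD.
Qed.

End MallowsMarginals.

(** Inverses are taken because their factors lie in [0, 1], as [cvg_prod_expR] requires. In
    [K = x + x ^+ 2], the term [x] pays for [j = 0] and [x ^+ 2] for the other factors. *)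
Lemma cvg_prod_qnumV {R : realType} (x : R) : 0 <= x ->
  (\prod_(j < n) qnum j (x / n%:R))^-1 @[n --> \oo] --> expR (- x).
Proof.
move=> x0; have q0 n : 0 <= x / n%:R by rewrite divr_ge0.
under eq_fun do rewrite -prodfV.
apply: (@cvg_prod_expR R (fun n (j : 'I_n) => (qnum j (x / n%:R))^-1) x (x + x ^+ 2)) => //.
- by rewrite addr_ge0// sqr_ge0.
- by move=> n j; rewrite invr_ge0 ltW ?qnum_gt0//= invf_le1 ?qnum_gt0 ?qnum_ge1.
- move=> n j; have n0 : (0 : R) < n%:R by rewrite ltr0n (leq_ltn_trans _ (ltn_ord j)).
  have n1 : (1 : R) <= n%:R by rewrite ler1n -(ltr0n R).
  have H : (x / n%:R) ^+ 2 <= x ^+ 2 / n%:R.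
    rewrite expr_div_n ler_wpM2l ?sqr_ge0// lef_pV2 ?posrE ?exprn_gt0//.
    by rewrite expr2 ler_peMr// ltW.
  have /andP[s0 s1] : 0 <= (qnum j (x / n%:R))^-1 <= 1.
    by rewrite invr_ge0 ltW ?qnum_gt0//= invf_le1 ?qnum_gt0 ?qnum_ge1.
  have [j0|j0] := posnP (nat_of_ord j).
    rewrite j0 /qnum big_ord_recl big_ord0 expr0 addr0 invr1 opprB addrC subrK.
    by rewrite ger0_norm// ler_wpM2r ?invr_ge0 ?ler0n// lerDl sqr_ge0.
  have /andP[? ?] := qnumV_bounds (q0 n) j0.
  rewrite mulrDl ler_norml; have Hq := q0 n; apply/andP; split; lra.
- move=> n j j0; have /andP[? ?] := qnumV_bounds (q0 n) j0.
  have -> : (x + x ^+ 2) / n%:R ^+ 2 = x / n%:R ^+ 2 + (x / n%:R) ^+ 2.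
    by rewrite expr_div_n mulrDl.
  have : 0 <= x / n%:R ^+ 2 by rewrite divr_ge0 ?exprn_ge0.
  have := sqr_ge0 (x / n%:R); rewrite ler_norml => ? ?; apply/andP; split; lra.
Qed.

(** * Poisson and Gamma laws *)

Section PoissonGeneratingFunction.
Context {R : realType}.

Lemma cvg_poisson_mass_pgf (l z : R) :
  \sum_(a < K) z ^+ a * poisson_mass l a @[K --> \oo] --> expR (- (l * (1 - z))).
Proof.
have -> : - (l * (1 - z)) = z * l - l by ring.
rewrite expRD.
have E K : \sum_(a < K) z ^+ a * poisson_mass l a = series (exp_coeff (z * l)) K * expR (- l).
  rewrite seriesEord mulr_suml; apply: eq_bigr => a _.
  by rewrite /poisson_mass /exp_coeff /= exprMn !mulrA.
under eq_fun do rewrite E; apply: cvgMl.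
exact: is_cvg_series_exp_coeff.
Qed.

Context {d : measure_display} {T : measurableType d} (P : probability T R) (m : nat).
Context (D : T -> {ffun 'I_m -> nat}) (l : 'I_m -> R).
Hypotheses (mD : forall a : {ffun 'I_m -> nat}, measurable [set w | D w = a])
  (massD : forall a : {ffun 'I_m -> nat}, Pr P [set w | D w = a] = \prod_i poisson_mass (l i) (a i)).

(** A truncated generating function: it involves finitely many masses, so its expectation factorises
    by plain distributivity. *)
Let trunc (z : 'I_m -> R) K (v : {ffun 'I_m -> nat}) : R :=
  \prod_i \sum_(a < K) z i ^+ a * (v i == a)%:R.

Let truncE z K v : trunc z K v =
  if [forall i, v i < K]%N then \prod_i z i ^+ v i else 0.
Proof.
rewrite /trunc; case: ifPn => [/forallP vK|/forallPn[i]].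
  apply: eq_bigr => i _; rewrite (bigD1 (Ordinal (vK i)))//= eqxx mulr1 big1 ?addr0// => a /eqP av.
  by case: eqP => [E|_]; rewrite ?mulr0//; case: av; apply: val_inj; rewrite /= E.
rewrite -leqNgt => Ki; rewrite (bigD1 i)//= big1 ?mul0r// => a _.
by rewrite gtn_eqF ?mulr0// (leq_trans (ltn_ord a)).
Qed.

Let Ex_trunc z K : Ex P (fun w => trunc z K (D w)) =
  \prod_i \sum_(a < K) z i ^+ a * poisson_mass (l i) a.
Proof.
pose v (a : {ffun 'I_m -> 'I_K}) : {ffun 'I_m -> nat} := [ffun i => a i : nat].
transitivity (Ex P (fun w => \sum_(a : {ffun 'I_m -> 'I_K})
    (\prod_i z i ^+ a i) * \1_[set w | D w = v a] w)).
  congr Ex; apply/funext => w; rewrite /trunc bigA_distr_bigA; apply: eq_bigr => a _.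
  rewrite big_split /= indicE.
  have [Da|Da] := pselect (D w = v a).
    by rewrite mem_set// [X in _ * X]big1// => i _; rewrite Da ffunE eqxx.
  rewrite memNset//; have [i ia] : exists i, D w i != a i.
    apply/existsP; apply: contrapT => /negP; rewrite negb_exists => /forallP H.
    by apply: Da; apply/ffunP => i; rewrite ffunE; apply/eqP/negbNE/H.
  by rewrite [X in _ * X](bigD1 i)//= (negbTE ia) mul0r.
rewrite Ex_sum; last by move=> a; apply: brvM (brv_cst _) (brv_indic _).
rewrite bigA_distr_bigA; apply: eq_bigr => a _.
rewrite ExZ ?Ex_indic ?massD//; last exact: brv_indic.
by rewrite -big_split /=; apply: eq_bigr => i _; rewrite ffunE.
Qed.

Lemma Ex_prod_poisson (z : 'I_m -> R) : (forall i, 0 <= z i <= 1) ->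
  Ex P (fun w => \prod_i z i ^+ D w i) = \prod_i expR (- (l i * (1 - z i))).
Proof.
move=> z01; set g := \prod_i expR _.
have cvgG (y : 'I_m -> R) : \prod_i \sum_(a < K) y i ^+ a * poisson_mass (l i) a @[K --> \oo] -->
    \prod_i expR (- (l i * (1 - y i))).
  apply: cvg_big => [|i _]; first exact: mul_continuous.
  exact: cvg_poisson_mass_pgf.
have zD0 (y : 'I_m -> R) v : (forall i, 0 <= y i <= 1) -> 0 <= \prod_i y i ^+ v i <= 1.
  move=> y01; rewrite prodr_ge0/=; last first.
    by move=> i _; rewrite exprn_ge0//; case/andP: (y01 i).
  apply: prodr_ile1 => i _; case/andP: (y01 i) => y0 y1.
  by rewrite exprn_ge0//= exprn_ile1.
have one01 (i : 'I_m) : 0 <= (1 : R) <= 1 by rewrite ler01 lexx.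
have btr y K : (forall i, 0 <= y i <= 1) -> brv (fun w => trunc y K (D w)).
  move=> y01; apply: (@brv_count _ _ _ _ D (trunc y K) 1) => // v; rewrite truncE.
  by case: ifP => _; rewrite ?normr0// ger0_norm; case/andP: (zD0 y v y01).
have bz : brv (fun w => \prod_i z i ^+ D w i).
  apply: (@brv_count _ _ _ _ D (fun v => \prod_i z i ^+ v i) 1) => // v.
  by rewrite ger0_norm; case/andP: (zD0 z v z01).
(* As [z] has entries in [0, 1], the truncation error is dominated by the probability that some
   coordinate is at least [K], that is, by the same error at z = 1; this tends to 0 since the
   Poisson masses sum to 1. *)
have bound K : `|Ex P (fun w => \prod_i z i ^+ D w i) - Ex P (fun w => trunc z K (D w))| <=
    1 - Ex P (fun w => trunc (fun=> 1) K (D w)).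
  have -> : 1 - Ex P (fun w => trunc (fun=> 1) K (D w)) =
      Ex P (fun w => 1 - trunc (fun=> 1) K (D w)).
    by rewrite ExB ?Ex_cst//; [exact: brv_cst|exact: btr].
  rewrite -ExB//; last exact: btr.
  apply: Ex_norm_le.
  - exact: brvB bz (btr _ _ z01).
  - exact: brvB (brv_cst 1) (btr _ _ one01).
  move=> w; rewrite !truncE; case: ifP => _.
    rewrite subrr normr0 big1 ?subrr// => i _; exact: expr1n.
  by rewrite !subr0 ger0_norm; case/andP: (zD0 z (D w) z01).
apply/eqP; rewrite -subr_eq0 -normr_le0.
have lim1 : `|Ex P (fun w => \prod_i z i ^+ D w i) - Ex P (fun w => trunc z K (D w))|
    @[K --> \oo] --> `|Ex P (fun w => \prod_i z i ^+ D w i) - g|.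
  apply: cvg_norm; apply: cvgB; first exact: cvg_cst.
  by under eq_fun do rewrite Ex_trunc; exact: cvgG.
have lim2 : 1 - Ex P (fun w => trunc (fun=> 1) K (D w)) @[K --> \oo] --> (0 : R).
  rewrite -[X in _ --> X](subrr 1); apply: cvgB; first exact: cvg_cst.
  under eq_fun do rewrite Ex_trunc.
  have := cvgG (fun=> 1); rewrite [X in _ --> X]big1// => i _.
  by rewrite subrr mulr0 oppr0 expR0.
by apply: (ler_cvg_to lim1 lim2); apply: nearW => K; exact: bound.
Qed.

End PoissonGeneratingFunction.

Section GammaDistribution.
Context {R : realType}.
Notation mu := (@lebesgue_measure R).

Lemma poisson_mass_ge0 (x : R) a : 0 <= x -> 0 <= poisson_mass x a.
Proof. by move=> x0; rewrite mulr_ge0 ?expR_ge0// divr_ge0// exprn_ge0. Qed.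

(** Only the term x^(a+1)/(a+1)! of the exponential series is kept in the denominator. *)
Lemma poisson_mass_le (x : R) a : 0 < x -> poisson_mass x a <= a.+1%:R / x.
Proof.
move=> x0; have := expR_ge1Dxn a (ltW x0).
set e := expR x => He; have e0 : 0 < e by exact: expR_gt0.
have f0 : (0 : R) < (a.+1)`!%:R by rewrite ltr0n fact_gt0.
have g0 : (0 : R) < a`!%:R by rewrite ltr0n fact_gt0.
rewrite /poisson_mass expRN -/e ler_pdivrMr// [X in _ <= X]mulrAC ler_pdivlMr// mulrAC ler_pdivrMr//.
have H : x ^+ a.+1 <= e * (a.+1)`!%:R by rewrite -ler_pdivrMr//; lra.
by move: H; rewrite factS natrM exprS; lra.
Qed.

Lemma cvg_poisson_mass (a : nat) : poisson_mass x a @[x --> +oo] --> (0 : R).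
Proof.
apply: (@squeeze_cvgr _ _ _ _ (fun=> 0) (fun x : R => a.+1%:R * x^-1)).
- near=> x; have x0 : 0 < x by near: x; exact: nbhs_pinfty_gt.
  by rewrite (poisson_mass_ge0 _ (ltW x0)) poisson_mass_le.
- exact: cvg_cst.
- rewrite -[X in _ --> X](mulr0 a.+1%:R); apply: cvgMr.
  apply/gtr0_cvgV0; last exact: cvg_id.
  exact: nbhs_pinfty_gt.
Unshelve. all: by end_near. Qed.

(** The probability that a Poisson variable of mean [x] is below [k]; for [k > 0] it is also the
    survival function of Gamma(k, 1). *)
Definition gamma_tail k (x : R) : R := \sum_(i < k) poisson_mass x i.

Lemma is_derive_poisson_mass a (x : R) :
  is_derive x 1 (fun y => poisson_mass y a.+1) (poisson_mass x a - poisson_mass x a.+1).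
Proof.
have H1 : is_derive x 1 ((@id R) ^+ a.+1) ((a.+1%:R * x ^+ a) *: 1).
  exact: is_deriveX.
have H2 : is_derive x 1 (expR \o -%R) (expR (- x) * -1).
  by apply: is_derive1_comp; apply: is_deriveN.
have := is_deriveZ (a.+1)`!%:R^-1 (is_deriveM H1 H2).
set f := (X in is_derive _ _ X); set df := (X in is_derive _ _ _ X -> _) => Hf.
have -> : (fun y => poisson_mass y a.+1) = f.
  apply/funext => y; rewrite /poisson_mass /f /=.
  by rewrite /GRing.scale /= !fctE /=; ring.
suff <- : df = poisson_mass x a - poisson_mass x a.+1 by [].
rewrite /df /poisson_mass /GRing.scale /= !fctE /= factS natrM invfM.
have f0 : (a`!%:R : R) != 0 by rewrite pnatr_eq0 -lt0n fact_gt0.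
by rewrite exprS; field; rewrite f0 nat1r pnatr_eq0.
Qed.

(** The derivative of the mass at a + 1 is the mass at a minus the mass at a + 1, so the sum
    telescopes to the top mass, which is the density. *)
Lemma is_derive_gamma_tail k (x : R) :
  is_derive x 1 (fun y => - gamma_tail k.+1 y) (gamma_pdf k.+1 x).
Proof.
elim: k => [|k IH].
  have H2 : is_derive x 1 (expR \o -%R) (expR (- x) * -1).
    by apply: is_derive1_comp; apply: is_deriveN.
  have := is_deriveN H2; set df := (X in is_derive _ _ _ X -> _) => Hf.
  have -> : (fun y => - gamma_tail 1 y) = - (expR \o -%R).
    by apply/funext => y; rewrite /gamma_tail big_ord_recl big_ord0 addr0 /poisson_mass
      expr0 fact0 divr1 mul1r.
  suff <- : df = gamma_pdf 1 x by [].
  by rewrite /df /gamma_pdf expr0 fact0 divr1 mul1r mulrN1 opprK.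
have := is_deriveB IH (is_derive_poisson_mass k x).
set f := (X in is_derive _ _ X); set df := (X in is_derive _ _ _ X -> _) => Hf.
have -> : (fun y => - gamma_tail k.+2 y) = f.
  by apply/funext => y; rewrite /f /gamma_tail /= big_ord_recr/= opprD.
suff <- : df = gamma_pdf k.+2 x by [].
rewrite /df /gamma_pdf /poisson_mass /=; ring.
Qed.

Lemma gamma_tail0 k : gamma_tail k.+1 0 = 1.
Proof.
rewrite /gamma_tail big_ord_recl big1 => [|i _].
  by rewrite addr0 /poisson_mass expr0 fact0 divr1 mul1r oppr0 expR0.
by rewrite /poisson_mass expr0n mul0r mul0r.
Qed.

Lemma cvg_gamma_tail k : gamma_tail k x @[x --> +oo] --> (0 : R).
Proof.
rewrite (_ : 0 = \sum_(i < k) 0); last by rewrite big1.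
apply: cvg_big => [|i _]; first exact: add_continuous.
exact: cvg_poisson_mass.
Qed.

Lemma continuous_gamma_pdf k : continuous (@gamma_pdf R k).
Proof.
move=> x; apply: cvgM; last exact: cvg_cst.
apply: cvgM; first exact: exprn_continuous.
apply: (@cvg_comp _ _ _ -%R expR); last exact: continuous_expR.
exact: oppr_continuous.
Qed.

Lemma gamma_pdf_ge0 k (x : R) : 0 <= x -> 0 <= gamma_pdf k x.
Proof. by move=> x0; rewrite divr_ge0// mulr_ge0 ?exprn_ge0 ?expR_ge0. Qed.

Lemma continuous_gamma_tail k (x : R) : {for x, continuous (fun y => - gamma_tail k.+1 y)}.
Proof.
apply: differentiable_continuous; apply/derivable1_diffP.
by have [] := is_derive_gamma_tail k x.
Qed.

Lemma integral_gamma_pdf_itv k (x : R) : 0 <= x ->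
  (\int[mu]_(y in `[0%R, x]) (gamma_pdf k.+1 y)%:E = (1 - gamma_tail k.+1 x)%R%:E)%E.
Proof.
rewrite le_eqVlt => /orP[/eqP <-|x0].
  by rewrite set_itv1 integral_set1 gamma_tail0 subrr.
rewrite (@continuous_FTC2 _ _ (fun y => - gamma_tail k.+1 y))//.
- by rewrite gamma_tail0 -EFinB; congr (_%:E); ring.
- by apply: continuous_subspaceT; exact: continuous_gamma_pdf.
- split.
  + by move=> y _; have [] := is_derive_gamma_tail k y.
  + by apply: cvg_at_right_filter; exact: continuous_gamma_tail.
  + by apply: cvg_at_left_filter; exact: continuous_gamma_tail.
- by move=> y _; rewrite derive1E; have [] := is_derive_gamma_tail k y.
Qed.

Lemma integral_gamma_pdf k :
  (\int[mu]_(y in `[0%R, +oo[) (gamma_pdf k.+1 y)%:E = 1)%E.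
Proof.
rewrite (@ge0_continuous_FTC2y _ _ (fun y => - gamma_tail k.+1 y) _ 0)//.
- by rewrite gamma_tail0 -EFinB sub0r opprK.
- by move=> y y0; exact: gamma_pdf_ge0.
- by apply: continuous_subspaceT; exact: continuous_gamma_pdf.
- by rewrite -[X in _ --> X]oppr0; apply: cvgN; exact: cvg_gamma_tail.
- by move=> y _; have [] := is_derive_gamma_tail k y.
- by apply: cvg_at_right_filter; exact: continuous_gamma_tail.
- by move=> y _; rewrite derive1E; have [] := is_derive_gamma_tail k y.
Qed.

End GammaDistribution.

(** The law Gamma(k + 1, 1): the shift of the index avoids the shape 0. The density is extended by 0
    to the whole line. *)
Definition gamma_prob {R : realType} (k : nat) (A : set (measurableTypeR R)) : \bar R :=
  (\int[lebesgue_measure]_(x in A) ((@gamma_pdf R k.+1 \_ `[0%R, +oo[) x)%:E)%E.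

Section GammaProbability.
Context {R : realType} (k : nat).
Notation mu := (@lebesgue_measure R).
Notation pdf := (@gamma_pdf R k.+1 \_ `[0%R, +oo[).

Lemma gamma_density_ge0 x : 0 <= pdf x.
Proof.
rewrite patchE; case: ifPn => // /set_mem/=; rewrite in_itv/= andbT.
exact: gamma_pdf_ge0.
Qed.

Lemma measurable_gamma_density : measurable_fun setT pdf.
Proof.
apply/(measurable_restrictT _ _).1 => //; apply: measurable_funTS.
by apply: continuous_measurable_fun; exact: continuous_gamma_pdf.
Qed.

Let gamma0 : @gamma_prob R k set0 = 0%E.
Proof. by rewrite /gamma_prob integral_set0. Qed.

Let gamma_ge0 A : (0 <= @gamma_prob R k A)%E.
Proof. by apply: integral_ge0 => x _; rewrite lee_fin gamma_density_ge0. Qed.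

Let gamma_sigma_additive : semi_sigma_additive (@gamma_prob R k).
Proof.
move=> /= F mF tF mUF; rewrite /gamma_prob; apply: cvg_toP.
  apply: ereal_nondecreasing_is_cvgn => m n mn.
  apply: lee_sum_nneg_natr => // j _ _; exact: gamma_ge0.
rewrite ge0_integral_bigcup//=.
- by apply/measurable_funTS/measurableT_comp => //; exact: measurable_gamma_density.
- by move=> x _; rewrite lee_fin gamma_density_ge0.
Qed.

HB.instance Definition _ := isMeasure.Build _ _ _
  (@gamma_prob R k) gamma0 gamma_ge0 gamma_sigma_additive.

Lemma gamma_probE (A : set R) : gamma_prob k A = (\int[mu]_(x in A `&` `[0%R, +oo[) (gamma_pdf k.+1 x)%:E)%E.
Proof.
rewrite /gamma_prob integral_mkcondr; apply: eq_integral => x _.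
by rewrite restrict_EFin.
Qed.

Let gamma_setT : @gamma_prob R k setT = 1%E.
Proof. by rewrite gamma_probE setTI integral_gamma_pdf. Qed.

HB.instance Definition _ :=
  @Measure_isProbability.Build _ _ R (@gamma_prob R k) gamma_setT.

(** [Num.max 0 y] stands for the Gamma variable, since [weak_cvg_of_cdf] asks for variables that are
    nonnegative everywhere and not merely almost surely. *)
Lemma gamma_prob_itv (x : R) : 0 <= x ->
  Pr (@gamma_prob R k) [set y | Num.max 0 y <= x] = 1 - gamma_tail k.+1 x.
Proof.
move=> x0; rewrite /Pr -[X in fine X]/(gamma_prob k _) gamma_probE (_ : _ `&` _ = `[0, x]%classic).
  by rewrite integral_gamma_pdf_itv.
apply/seteqP; split => y /=; rewrite !in_itv/= andbT ge_max x0 /=.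
  by move=> [-> ->].
by move=> /andP[-> ->].
Qed.

(** The Radon-Nikodym derivative of [gamma_prob k] has the same integrals as the density over all
    measurable sets, hence equals it almost everywhere and may be replaced by it in the change of
    variables. *)
Lemma Ex_gamma_prob (F : R -> R) : brv (F : measurableTypeR R -> R) ->
  (Ex (@gamma_prob R k) F)%:E = (\int[mu]_(x in `[0%R, +oo[) (F x * gamma_pdf k.+1 x)%:E)%E.
Proof.
move=> bF; have iF := brv_integrable (@gamma_prob R k) bF.
rewrite /Ex /Rintegral fineK; last exact: integrable_fin_num.
have dom : gamma_prob k `<< mu.
  apply/null_content_dominatesP => A mA A0; apply: null_set_integral => //.
  by apply: measurable_funTS; apply/measurable_EFinP; exact: measurable_gamma_density.
rewrite -(Radon_Nikodym_change_of_variables dom)//=.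
transitivity (\int[mu]_x (F x * pdf x)%:E)%E.
  apply: ae_eq_integral => //.
  - apply: emeasurable_funM; first exact: measurable_int iF.
    by apply: (measurable_int mu); exact: Radon_Nikodym_integrable.
  - apply/measurable_EFinP/measurable_funM; first exact: bF.1.
    exact: measurable_gamma_density.
  under [X in ae_eq _ _ _ X]eq_fun do rewrite EFinM.
  apply: ae_eqe_mul2l => /=; apply: integral_ae_eq => //=.
  - exact: Radon_Nikodym_integrable.
  - by apply/measurable_EFinP; exact: measurable_gamma_density.
  - by move=> E _ mE; rewrite -Radon_Nikodym_integral//; exact: dom.
rewrite [RHS]integral_mkcond; apply: eq_integral => x _; rewrite !patchE.
by case: ifP; rewrite ?mulr0.
Qed.

End GammaProbability.

(** * Jump times of monotone Mallows processes *)

Section CountingProbabilities.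
Context {R : realType} {d : measure_display} {T : measurableType d} (P : probability T R).

Lemma Pr_nat_lt (xi : T -> nat) k : (forall a, measurable [set w | xi w = a]) ->
  Pr P [set w | (xi w < k)%N] = \sum_(a < k) Pr P [set w | xi w = a].
Proof.
move=> mxi; rewrite -Ex_indic; last exact: (measurable_preimage_count (fun a => a < k)%N mxi).
transitivity (Ex P (fun w => \sum_(a < k) \1_[set w | xi w = a] w)).
  congr Ex; apply/funext => w; rewrite indicE; have [wk|kw] := ltnP (xi w) k.
    rewrite mem_set// (bigD1 (Ordinal wk))//= indicE mem_set// big1 ?addr0// => a /eqP aw.
    by rewrite indicE memNset//= => E; apply: aw; apply: val_inj.
  rewrite memNset/=; last by rewrite ltnNge kw.
  rewrite big1// => a _; rewrite indicE memNset//= => E.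
  by have := ltn_ord a; rewrite -E ltnNge kw.
by rewrite Ex_sum => [|a]; [apply: eq_bigr => a _; rewrite Ex_indic|exact: brv_indic].
Qed.

Lemma Pr_nat_ge (xi : T -> nat) k : (forall a, measurable [set w | xi w = a]) ->
  Pr P [set w | (k <= xi w)%N] = 1 - \sum_(a < k) Pr P [set w | xi w = a].
Proof.
move=> mxi; rewrite -Pr_nat_lt// -Pr_setC.
  congr Pr; apply/seteqP; split => w /=; first by move=> kw; apply/negP; rewrite -leqNgt.
  by move=> /negP; rewrite -leqNgt.
exact: (measurable_preimage_count (fun a => a < k)%N mxi).
Qed.

Lemma integral_brv (X : T -> R) : brv X -> (\int[P]_w (X w)%:E)%E = (Ex P X)%:E.
Proof.
by move=> bX; rewrite /Ex /Rintegral fineK//; exact: integrable_fin_num (brv_integrable P bX).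
Qed.

End CountingProbabilities.

Section MallowsCounting.
Context {R : realType} {d : measure_display} {T : measurableType d} (P : probability T R).
Context (n : nat) (M : T -> R -> 'S_n).
Hypothesis mM : monotone_mallows P M.

Let c (w : T) (t : R) := Defs.Inv (M w t).

Lemma mallows_counting : counting_process c.
Proof.
have [mp mono] := mM; split => [w|t a t0]; last first.
  exact: (measurable_mallows_event mp (fun s => Defs.Inv s = a)).
split => [s t s0|t t0].
  by rewrite le_eqVlt => /orP[/eqP -> //|st]; exact: mono.
have [rc _] := mp.1 w; have [e e0 He] := rc t t0.
by exists e => // s ts st; rewrite /c He.
Qed.

(** As t grows the Mallows law leaves the permutations with fewer than [k] inversions: [mallows_Z]
    is at least t^(0 + ... + (n-1)) >= t^k, where [k < n] enters, so each of them has mass at most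
    1/t. *)
Lemma Pr_never_mallows k : (k < n)%N -> Pr P (never c k) = 0.
Proof.
move=> kn; apply: (Pr_never mallows_counting) => e e0.
pose N : R := #|{perm 'I_n}|%:R.
(* Chosen so that n!/t <= e, together with t >= 1 for comparing powers. *)
pose t := 1 + N / e; have N0 : 0 <= N / e by rewrite divr_ge0// ltW.
have t1 : 1 <= t by rewrite lerDl.
have t0 : 0 < t by exact: lt_le_trans ltr01 t1.
exists t; first exact: ltW.
rewrite /c (Pr_mallows mM.1 (fun s => Defs.Inv s < k)%N) ?(ltW t0)//.
have Z0 : 0 < mallows_Z n t by apply: prodr_gt0 => j _; apply: qnum_gt0; exact: ltW.
have tZ : t ^+ k <= mallows_Z n t.
  apply: (@le_trans _ _ (t ^+ (\sum_(j < n) j)%N)).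
    rewrite ler_weXn2l//; case: (n) kn => // n' kn; rewrite big_ord_recr /=.
    by rewrite (leq_trans _ (leq_addl _ _)).
  rewrite expr_sum; apply: ler_prod => j _; rewrite exprn_ge0 ?(ltW t0)//=.
  by rewrite big_ord_recr/= lerDr sumr_ge0// => l _; rewrite exprn_ge0// ltW.
apply: (@le_trans _ _ (\sum_(s : 'S_n) t^-1)).
  apply: ler_sum => s _; have [sk|_] := ltnP (Defs.Inv s) k; last first.
    by rewrite mul0r invr_ge0 (ltW t0).
  rewrite mul1r /mallows ler_pdivrMr// mulrC ler_pdivlMr//.
  by rewrite -exprSr (le_trans _ tZ)// ler_weXn2l.
rewrite sumr_const -[_ *+ _]mulr_natl ler_pdivrMr// -/N /t mulrDr mulr1 mulrC divfK ?gt_eqF//.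
by rewrite lerDr ltW.
Qed.

End MallowsCounting.

Section OneDimensionalLimit.
Context {R : realType} (d : nat -> measure_display)
  (Om : forall n : nat, measurableType (d n)) (P : forall n : nat, probability (Om n) R)
  (M : forall n : nat, Om n -> R -> 'S_n).
Hypothesis mM : forall n, monotone_mallows (P n) (@M n).

Lemma poisson_prob_mass (x : R) (k a : nat) : 0 <= x ->
  Pr (poisson_prob x k) [set a] = poisson_mass x a.
Proof.
move=> x0; rewrite /Pr -[X in fine X]/(poisson_prob x k [set a]) /poisson_prob.
case: ltP => [x1|x1].
  by rewrite esum_set1 ?lee_fin ?poisson_pmf_ge0//= /poisson_pmf x1.
have -> : x = 0 by apply/eqP; rewrite eq_le x0 x1.
rewrite diracE /poisson_mass oppr0 expR0 mulr1; case: a => [|a].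
  by rewrite mem_set//= expr0 fact0 divr1.
by rewrite memNset//= expr0n mul0r.
Qed.

Lemma cvg_Pr_Inv_ge (x : R) k : 0 <= x ->
  Pr (P n) [set w | (k <= Defs.Inv (M w (x / n%:R)))%N] @[n --> \oo] --> 1 - gamma_tail k x.
Proof.
move=> x0; have q0 n : 0 <= x / n%:R by rewrite divr_ge0.
pose Q := poisson_prob x 0.
pose V n (w : Om n) : {ffun 'I_1 -> nat} := [ffun=> Defs.Inv (M w (x / n%:R))].
pose V' (a : nat) : {ffun 'I_1 -> nat} := [ffun=> a].
have mV n v : measurable [set w : Om n | V n w = v].
  exact: (measurable_mallows_event (mM n).1 (fun s => [ffun=> Defs.Inv s] = v) (q0 n)).
have mV' v : measurable [set w | V' w = v] by [].
have massV' (a : {ffun 'I_1 -> nat}) :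
    Pr Q [set w | V' w = a] = \prod_i poisson_mass x (a i).
  rewrite big_ord1 -(poisson_prob_mass 0 _ x0); congr Pr; apply/seteqP; split => w /=.
    by move=> <-; rewrite ffunE.
  by move=> ->; apply/ffunP => i; rewrite ffunE [i]ord1.
have lap (r : 'I_1 -> nat) : Ex (P n) (fun w => half_pow r (V n w)) @[n --> \oo] -->
    Ex Q (fun w => half_pow r (V' w)).
  pose z : R := 2^-1 ^+ r ord0.
  have z0 : 0 <= z by rewrite exprn_ge0// invr_ge0.
  have z1 : z <= 1 by rewrite exprn_ile1 ?invr_ge0// invf_le1// ler1n.
  have hE v : half_pow r v = \prod_i z ^+ v i by rewrite /half_pow /hpow !big_ord1 exprM.
  rewrite (_ : (fun w => half_pow r (V' w)) = (fun w => \prod_i z ^+ V' w i)); last first.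
    by apply/funext => w; rewrite hE.
  rewrite (Ex_prod_poisson (l := fun=> x) mV' massV' (z := fun=> z)); last by move=> _; rewrite z0.
  rewrite big_ord1.
  (* The numerator is inverted twice because [cvg_prod_qnumV] speaks of inverse products. *)
  have E n : Ex (P n) (fun w => half_pow r (V n w)) =
      ((\prod_(j < n) qnum j (z * x / n%:R))^-1)^-1 * (\prod_(j < n) qnum j (x / n%:R))^-1.
    rewrite invrK -mulrA -(Ex_mallows_Inv (mM n).1 z0 (q0 n)); congr Ex; apply/funext => w.
    by rewrite hE big_ord1 ffunE.
  under eq_fun do rewrite E.
  have -> : - (x * (1 - z)) = z * x + - x by ring.
  rewrite expRD; apply: cvgM; last exact: cvg_prod_qnumV.
  rewrite -[expR (z * x)]invrK -expRN; apply: cvgV; first by rewrite gt_eqF// expR_gt0.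
  by apply: cvg_prod_qnumV; exact: mulr_ge0.
have : Pr (P n) [set w | [forall l : 'I_1, k <= V n w l]%N] @[n --> \oo] -->
    Pr Q [set w | [forall l : 'I_1, k <= V' w l]%N].
  exact: (cvg_Pr_of_laplace mV mV' lap (b := fun=> k)).
have -> : Pr Q [set w | [forall l, k <= V' w l]%N] = 1 - gamma_tail k x.
  rewrite (_ : [set w | _] = [set w | (k <= w)%N]).
    rewrite (Pr_nat_ge Q (xi := id))//; congr (_ - _).
    by apply: eq_bigr => a _; rewrite -(poisson_prob_mass 0 _ x0).
  apply/seteqP; split => w /=; first by move/forallP/(_ ord0); rewrite ffunE.
  by move=> kw; apply/forallP => l; rewrite ffunE.
rewrite (_ : (fun n => Pr (P n) [set w | (k <= Defs.Inv (M w (x / n%:R)))%N]) =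
  (fun n => Pr (P n) [set w | [forall l, k <= V n w l]%N]))//.
apply/funext => n; congr Pr; apply/seteqP; split => w /=.
  by move=> kw; apply/forallP => l; rewrite ffunE.
by move/forallP/(_ ord0); rewrite ffunE.
Qed.

End OneDimensionalLimit.

Section ScaledJumpTimes.
Context {R : realType} {d : measure_display} {T : measurableType d} (P : probability T R).
Context (n : nat) (M : T -> R -> 'S_n).
Hypothesis mM : monotone_mallows P M.

Lemma measurable_jump_time k : measurable_fun setT (fun w => n%:R * jump_time (M w) k).
Proof.
apply: measurable_funM; first exact: measurable_cst.
exact: (measurable_kth_point (mallows_counting mM) k).
Qed.

Lemma jump_time_ge0 w k : 0 <= n%:R * jump_time (M w) k.
Proof. by rewrite mulr_ge0//; exact: (kth_point_ge0 (fun t => Defs.Inv (M w t))). Qed.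

Lemma Pr_jump_time_tests k (s : seq (nat * R)) :
  all (fun p => (p.1 <= k)%N && (0 <= p.2)) s -> (k < n)%N ->
  Pr P [set w | all (fun p => n%:R * jump_time (M w) p.1 <= p.2) s] =
  Pr P [set w | all (fun p => p.1 <= Defs.Inv (M w (p.2 / n%:R)))%N s].
Proof.
move=> sk kn; have n0 : (0 : R) < n%:R by rewrite ltr0n (leq_ltn_trans _ kn).
pose s' := [seq (p.1, p.2 / n%:R) | p <- s].
have s'k : all (fun p => (p.1 <= k)%N && (0 <= p.2)) s'.
  rewrite all_map; apply: sub_all sk => p /= /andP[-> p0] /=.
  by rewrite divr_ge0// ltW.
have := Pr_kth_point_tests (mallows_counting mM) s'k (Pr_never_mallows mM kn).
rewrite (_ : [set w | _] = [set w | all (fun p => n%:R * jump_time (M w) p.1 <= p.2) s]).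
  by move=> ->; congr Pr; apply/seteqP; split => w; rewrite /= all_map.
have E w : all (fun p => kth_point (fun t => Defs.Inv (M w t)) p.1 <= p.2) s' =
    all (fun p => n%:R * jump_time (M w) p.1 <= p.2) s.
  by rewrite all_map; apply: eq_all => p /=; rewrite ler_pdivlMr// mulrC.
by apply/seteqP; split => w; rewrite /= E.
Qed.

End ScaledJumpTimes.

Section JumpTimeLimit.
Context {R : realType} (d : nat -> measure_display)
  (Om : forall n : nat, measurableType (d n)) (P : forall n : nat, probability (Om n) R)
  (M : forall n : nat, Om n -> R -> 'S_n).
Hypothesis mM : forall n, monotone_mallows (P n) (@M n).

(** With a single variable, finitely many comparisons amount to one with the least threshold; the
    empty list has none and is kept apart. *)
Lemma all_le_min (I : Type) (s : seq (I * R)) : all (fun p => 0 <= p.2) s ->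
  s = [::] \/ exists2 x : R, 0 <= x & forall y : R, all (fun p => y <= p.2) s = (y <= x).
Proof.
elim: s => [|p s IH] /=; first by left.
move=> /andP[p0 /IH[->|[x x0 sx]]]; right; first by exists p.2 => // y; rewrite andbT.
by exists (Num.min p.2 x); [rewrite le_min p0|move=> y; rewrite sx le_min].
Qed.

Theorem cvg_jump_time_gamma k (f : R -> R) C : continuous f -> (forall x, `|f x| <= C) ->
  ((fun n : nat => \int[P n]_w (f (n%:R * jump_time (M w) k.+1))%:E) @ \oo
    --> \int[lebesgue_measure]_(x in [set x : R | (0 <= x)%R]) (f x * gamma_pdf k.+1 x)%:E)%E.
Proof.
move=> cf fC; pose f1 (v : 'rV[R]_1) := f (v 0 0).
have cf1 : continuous f1.
  move=> v; apply: (@cvg_comp _ _ _ (fun v : 'rV[R]_1 => v 0 0) f); last exact: cf.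
  exact: coord_continuous.
have f1C v : `|f1 v| <= C by exact: fC.
pose Y n (w : Om n) (i : 'I_1) : R := n%:R * jump_time (M w) k.+1.
pose Y' (x : measurableTypeR R) (i : 'I_1) : R := Num.max 0 x.
have mY n i : measurable_fun setT (Y n ^~ i) by exact: measurable_jump_time (mM n) k.+1.
have Y0 n w i : 0 <= Y n w i by exact: jump_time_ge0.
have mY' i : measurable_fun setT (Y' ^~ i).
  by apply: measurable_maxr; [exact: measurable_cst|exact: measurable_id].
have Y'0 w i : 0 <= Y' w i by rewrite le_max lexx.
have cdf (s : seq ('I_1 * R)) : all (fun p => 0 <= p.2) s ->
    Pr (P n) [set w | all (fun p => Y n w p.1 <= p.2) s] @[n --> \oo] -->
    Pr (gamma_prob k) [set w | all (fun p => Y' w p.1 <= p.2) s].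
  case/all_le_min => [->|[x x0 sx]].
    have E dd (T : measurableType dd) (Q : probability T R) : Pr Q [set w | true] = 1.
      by rewrite -(Pr_setT Q); congr Pr; apply/seteqP; split.
    by rewrite /= E; under eq_fun do rewrite E; exact: cvg_cst.
  rewrite (_ : [set w | all (fun p => Y' w p.1 <= p.2) s] = [set y | Num.max 0 y <= x]); last first.
    by apply/seteqP; split => w; rewrite /= sx.
  rewrite gamma_prob_itv//.
  have L : Pr (P n) [set w | (k < Defs.Inv (M w (x / n%:R)))%N] @[n --> \oo] -->
      1 - gamma_tail k.+1 x by exact: cvg_Pr_Inv_ge.
  apply: cvg_trans L; apply: near_eq_cvg.
  near=> n; have kn : (k.+1 < n)%N by near: n; exact: nbhs_infty_gt.
  have := @Pr_jump_time_tests _ _ _ _ _ _ (mM n) k.+1 [:: (k.+1, x)] _ kn.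
  rewrite /= leqnn x0 => /(_ isT) H.
  suff : Pr (P n) [set w | all (fun p => Y n w p.1 <= p.2) s] =
      Pr (P n) [set w | (k < Defs.Inv (M w (x / n%:R)))%N] by move=> ->.
  transitivity (Pr (P n) [set w | (n%:R * jump_time (M w) k.+1 <= x) && true]).
    by congr Pr; apply/seteqP; split => w; rewrite /= sx andbT.
  by rewrite H; congr Pr; apply/seteqP; split => w; rewrite /= andbT.
have H := weak_cvg_of_cdf mY Y0 mY' Y'0 cdf cf1 f1C.
have E n w : f1 (\row_i Y n w i) = f (n%:R * jump_time (M w) k.+1) by rewrite /f1 mxE.
have bY n : brv (fun w : Om n => f (n%:R * jump_time (M w) k.+1)).
  under eq_fun do rewrite -E; exact: (brv_continuous (mY n) (Y0 n) cf1 f1C).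
have -> : (fun n : nat => \int[P n]_w (f (n%:R * jump_time (M w) k.+1))%:E)%E =
    EFin \o (fun n => Ex (P n) (fun w => f1 (\row_i Y n w i))).
  apply/funext => n /=; rewrite integral_brv//; congr (_%:E); congr Ex; apply/funext => w.
  by rewrite E.
have bY' : brv (fun x : measurableTypeR R => f1 (\row_i Y' x i)).
  exact: (brv_continuous mY' Y'0 cf1 f1C).
have -> : (\int[lebesgue_measure]_(x in [set x : R | (0 <= x)%R]) (f x * gamma_pdf k.+1 x)%:E)%E =
    (Ex (gamma_prob k) (fun x => f1 (\row_i Y' x i)))%:E.
  rewrite Ex_gamma_prob// (_ : [set x : R | (0 <= x)%R] = `[0, +oo[%classic); last first.
    by apply/seteqP; split => x; rewrite /= in_itv/= andbT.
  apply: eq_integral => x /set_mem/=; rewrite in_itv/= andbT => x0.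
  by rewrite /f1 mxE /Y' max_r.
by apply: cvg_EFin; [exact: nearW|exact: H].
Unshelve. all: by end_near. Qed.

End JumpTimeLimit.

(** * Regular Mallows processes *)

(* A list of pairs (r, x) stands for the functional [2 ^ (- \sum r * N x)] of a
   counting path N. [rate_exponent] is its log-Laplace transform, up to sign, when
   N is a Poisson process of rate 1: by summation by parts it equals
   [\sum_i (x_i - x_(i-1)) * (1 - 2 ^ (- \sum_(l >= i) r_l))]. *)
Section RateExponent.
Context {R : realType}.
Implicit Types (s : seq (nat * R)) (p : nat * R).

Definition weight s : nat := \sum_(p <- s) p.1.

Fixpoint rate_exponent s : R :=
  if s is p :: s' then rate_exponent s' + p.2 * (hpow (weight s') - hpow (weight s)) else 0.

Definition time_sorted s := sorted (fun p q : nat * R => p.2 <= q.2) s.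

Lemma weight_cons p s : weight (p :: s) = (p.1 + weight s)%N.
Proof. by rewrite /weight big_cons. Qed.

Lemma hpow_weight_cons p s : hpow (weight (p :: s)) <= hpow (weight s) :> R.
Proof. by rewrite /hpow weight_cons ler_wiXn2l ?invr_ge0 ?invf_le1 ?ler1n// leq_addl. Qed.

Lemma time_sorted_cons p s : time_sorted (p :: s) ->
  time_sorted s /\ forall q, q \in s -> p.2 <= q.2.
Proof.
move=> ps; split; first exact: path_sorted ps.
have tr : transitive (fun p q : nat * R => p.2 <= q.2) by move=> y x z; exact: le_trans.
by move=> q qs; move: (order_path_min tr ps) => /allP/(_ q qs).
Qed.

Lemma rate_exponent_ge0 s : all (fun p => 0 <= p.2) s -> 0 <= rate_exponent s.
Proof.
elim: s => //= p s IH /andP[p0 s0]; rewrite addr_ge0 ?IH// mulr_ge0// subr_ge0.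
exact: hpow_weight_cons.
Qed.

Lemma rate_exponent_le s (X : R) : all (fun p => p.2 <= X) s ->
  rate_exponent s <= X * (1 - hpow (weight s)).
Proof.
elim: s => [_|p s IH] /=; first by rewrite /weight big_nil /hpow expr0 subrr mulr0.
move=> /andP[pX sX]; have := IH sX; have := hpow_weight_cons p s.
set a := hpow (weight s); set b := hpow (weight _) => ab H.
have : p.2 * (a - b) <= X * (a - b) by rewrite ler_wpM2r// subr_ge0.
lra.
Qed.

Lemma rate_exponent_scale s (n : nat) :
  rate_exponent [seq (p.1, p.2 / n%:R) | p <- s] = rate_exponent s / n%:R.
Proof.
have W s' : weight [seq (p.1, p.2 / n%:R) | p <- s'] = weight s'.
  by rewrite /weight big_map.
elim: s => [|p s IH] /=; first by rewrite mul0r.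
by rewrite IH !weight_cons W /=; ring.
Qed.

End RateExponent.

(** * The Laplace functional of a single process Inv_j *)

Section OneParticle.
Context {R : realType} {d : measure_display} {T : measurableType d} (P : probability T R).
Context (n : nat) (M : T -> R -> 'S_n).
Hypothesis smM : strongly_monotone_mallows P M.
Variable j : 'I_n.

Let I (t : R) (w : T) : R := (0 < Invj (M w t) j)%N%:R.

(** If the j-th process jumps at most once, its functional is 1 minus this sum. It is linear in the
    indicators [I], so its expectation involves one-time marginals only; replacing [I p.2] by [p.2]
    gives [rate_exponent]. *)
Let linear_part := fix lin (s : seq (nat * R)) (w : T) : R :=
  if s is p :: s' then lin s' w + I p.2 w * (hpow (weight s') - hpow (weight (p :: s'))) else 0.

Definition Invj_load (s : seq (nat * R)) w := (\sum_(p <- s) p.1 * Invj (M w p.2) j)%N.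

Let mp : mallows_process P M := smM.1.

Let Invj_mono w s t : 0 <= s -> s <= t -> (Invj (M w s) j <= Invj (M w t) j)%N.
Proof. by move=> s0; rewrite le_eqVlt => /orP[/eqP -> //|st]; apply: smM.2. Qed.

Let brv_fun (g : 'S_n -> R) t : 0 <= t -> brv (fun w => g (M w t)).
Proof. by move=> t0; apply: brv_fin => s; exact: (measurable_mallows mp s t0). Qed.

Let loadE s X w : time_sorted s -> all (fun p => 0 <= p.2 <= X) s -> (Invj (M w X) j <= 1)%N ->
  hpow (Invj_load s w) = 1 - linear_part s w.
Proof.
move=> + + le1; elim: s => [_ _|p s IH /time_sorted_cons[ss ps] /= /andP[/andP[p0 pX] sX]].
  by rewrite /Invj_load big_nil /hpow expr0 subr0.
rewrite /Invj_load big_cons /hpow exprD -/(hpow _) -/(hpow (Invj_load s w)) opprD addrA -IH// /I.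
(* Without a jump by the earliest time, this time contributes nothing. Otherwise the count is 1 at
   all later times too, and the load is the full weight. *)
have [p1|] := posnP (Invj (M w p.2) j).
  by rewrite p1 muln0 /hpow expr0 mul1r mul0r subr0.
move=> p1; have E (q : nat * R) : p.2 <= q.2 -> q.2 <= X -> Invj (M w q.2) j = 1%N.
  move=> pq qX; apply/eqP; rewrite eqn_leq (leq_trans p1) ?andbT//; last exact: Invj_mono.
  by apply: leq_trans le1; apply: Invj_mono => //; exact: le_trans pq.
have -> : Invj_load s w = weight s.
  rewrite /Invj_load /weight !big_seq; apply: eq_bigr => q qs; rewrite E ?muln1//; first exact: ps.
  by have /andP[] := allP sX q qs.
rewrite E// muln1 mul1r weight_cons /hpow exprD; ring.
Qed.

Let linear_part01 s w : 0 <= linear_part s w <= 1 - hpow (weight s).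
Proof.
elim: s => [|p s /andP[l0 l1]] /=.
  by rewrite /weight big_nil /hpow expr0 subrr lexx.
have := hpow_weight_cons p s; rewrite -subr_ge0 /I => H.
by case: (0 < _)%N; rewrite ?mul1r ?mul0r ?addr0; apply/andP; split; lra.
Qed.

Let brv_linear s : all (fun p => 0 <= p.2) s -> brv (linear_part s).
Proof.
elim: s => [_|p s IH /= /andP[p0 s0]]; first exact: brv_cst.
apply: brvD; first exact: IH.
by apply: brvM (brv_cst _); apply: (brv_fun (fun s => (0 < Invj s j)%N%:R)).
Qed.

(** Each marginal P(Inv_j > 0) at time t is within t^2 of t. The coefficients telescope to
    [1 - hpow (weight s)], so the error does not grow with the length of [s]. *)
Let Ex_linear s X : (0 < j)%N -> 0 <= X -> all (fun p => 0 <= p.2 <= X) s ->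
  `|Ex P (linear_part s) - rate_exponent s| <= X ^+ 2 * (1 - hpow (weight s)).
Proof.
move=> j0 X0; elim: s => [_|p s IH /= /andP[/andP[p0 pX] sX]].
  by rewrite Ex_cst subrr normr0 /weight big_nil /hpow expr0 subrr mulr0.
have s0 : all (fun p : nat * R => 0 <= p.2) s by apply: sub_all sX => q /andP[].
have bI : brv (I p.2) by apply: (brv_fun (fun s => (0 < Invj s j)%N%:R)).
set h := hpow (weight s) - _.
have h0 : 0 <= h by rewrite subr_ge0; exact: hpow_weight_cons.
rewrite ExD; [|exact: brv_linear|exact: brvM (brv_cst _)].
rewrite (_ : (fun w => I p.2 w * h) = (fun w => h * I p.2 w)); last first.
  by apply/funext => w; rewrite mulrC.
rewrite ExZ//.
have EI : Ex P (I p.2) = Pr P [set w | (0 < Invj (M w p.2) j)%N].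
  rewrite -Ex_indic; last exact: (measurable_mallows_event mp (fun s => 0 < Invj s j)%N).
  congr Ex; apply/funext => w; rewrite indicE /I; congr ((nat_of_bool _)%:R).
  by apply/idP/idP => [H|/set_mem//]; apply: mem_set.
have := Pr_Invj_ge1 mp p0 j0; rewrite -EI => /andP[e1 e2].
have pX2 : p.2 ^+ 2 <= X ^+ 2 by rewrite ler_pXn2r.
have : `|h * Ex P (I p.2) - p.2 * h| <= X ^+ 2 * h.
  rewrite [p.2 * h]mulrC -mulrBr normrM (ger0_norm h0) mulrC ler_wpM2r//.
  rewrite ler_norml; apply/andP; split; first lra.
  have := sqr_ge0 X; lra.
have := IH sX; rewrite /h; move: (hpow _) (hpow _) => a b.
rewrite !ler_norml => /andP[? ?] /andP[? ?]; apply/andP; split; lra.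
Qed.

Lemma Ex_hpow_Invj_load0 s : nat_of_ord j = 0%N ->
  Ex P (fun w => hpow (Invj_load s w)) = 1.
Proof.
move=> j0; rewrite -[RHS](Ex_cst P); congr Ex; apply/funext => w.
rewrite /Invj_load big1 ?expr0// => p _.
by have := Invj_le (M w p.2) j; rewrite j0 leqn0 => /eqP ->; rewrite muln0.
Qed.

Lemma brv_Invj_load s : all (fun p => 0 <= p.2) s -> brv (fun w => hpow (Invj_load s w) : R).
Proof.
elim: s => [_|p s IH /= /andP[p0 s0]].
  rewrite (_ : (fun w => _) = (fun=> 1)); first exact: brv_cst.
  by apply/funext => w; rewrite /Invj_load big_nil /hpow expr0.
rewrite (_ : (fun w => _) = (fun w => hpow (p.1 * Invj (M w p.2) j) * hpow (Invj_load s w) : R)).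
  by apply: brvM (IH s0); apply: (brv_fun (fun s => hpow (p.1 * Invj s j))).
by apply/funext => w; rewrite /Invj_load big_cons /hpow exprD.
Qed.

(** One [X ^+ 2] bounds the probability of two or more inversions at time [X], outside of which
    [loadE] is exact; the other comes from [Ex_linear]. *)
Lemma Ex_hpow_Invj_load s X : (0 < j)%N -> 0 <= X -> time_sorted s ->
  all (fun p => 0 <= p.2 <= X) s ->
  `|Ex P (fun w => hpow (Invj_load s w)) - (1 - rate_exponent s)| <= 2 * X ^+ 2.
Proof.
move=> j0 X0 ss sX.
have s0 : all (fun p : nat * R => 0 <= p.2) s by apply: sub_all sX => q /andP[].
have mA : measurable [set w | (1 < Invj (M w X) j)%N].
  exact: (measurable_mallows_event mp (fun s => 1 < Invj s j)%N).
have H1 : `|Ex P (fun w => hpow (Invj_load s w) - (1 - linear_part s w))| <= X ^+ 2.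
  apply: le_trans (Pr_Invj_ge2 mp j X0); rewrite -Ex_indic//; apply: Ex_norm_le.
  - by apply: brvB (brv_Invj_load s0) _; apply: brvB (brv_cst 1) (brv_linear s0).
  - exact: brv_indic.
  move=> w; rewrite indicE; have [le1|gt1] := leqP (Invj (M w X) j) 1.
    by rewrite (loadE ss sX le1) subrr normr0; case: (_ \in _).
  rewrite mem_set//=; have /andP[l0 l1] := linear_part01 s w.
  have := hpow_ge0 (R := R) (weight s); have := hpow_ge0 (R := R) (Invj_load s w).
  have := hpow_le1 (R := R) (Invj_load s w); rewrite ler_norml => *; apply/andP; split; lra.
rewrite ExB in H1; [|exact: brv_Invj_load|exact: brvB (brv_cst 1) (brv_linear s0)].
rewrite ExB ?Ex_cst in H1; [|exact: brv_cst|exact: brv_linear].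
have H2 : X ^+ 2 * (1 - hpow (weight s)) <= X ^+ 2.
  by rewrite ler_piMr ?sqr_ge0// lerBlDr lerDl hpow_ge0.
move: H1 (Ex_linear j0 X0 sX); rewrite !ler_norml => /andP[? ?] /andP[? ?].
apply/andP; split; lra.
Qed.

End OneParticle.

(** * Factorisation over j in the regular case *)

Section Independence.
Context {R : realType} {d : measure_display} {T : measurableType d} (P : probability T R).
Context (n : nat) (M : T -> R -> 'S_n).
Hypotheses (mp : mallows_process P M) (indep : inv_processes_independent P M).

Section Trajectories.
Context (m : nat) (x : 'I_m -> R).
Hypothesis x0 : forall l, 0 <= x l.

(** Going through [lehmer] puts the values of Inv_j at the chosen times in a finite type, so
    expectations are finite sums. *)
Definition trajectory (j : 'I_n) (w : T) : {ffun 'I_m -> 'I_n} :=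
  [ffun l => lehmer (M w (x l)) j].

Lemma measurable_trajectory (S : set ('I_n -> {ffun 'I_m -> 'I_n})) :
  measurable [set w | S (trajectory ^~ w)].
Proof.
pose path w : {ffun 'I_m -> 'S_n} := [ffun l => M w (x l)].
pose S' (p : {ffun 'I_m -> 'S_n}) := S (fun j => [ffun l => lehmer (p l) j]).
have -> : [set w | S (trajectory ^~ w)] = [set w | S' (path w)].
  apply/seteqP; split => w; rewrite /S' /=; congr S; apply/funext => j; apply/ffunP => l;
    by rewrite !ffunE.
apply: (measurable_preimage_count S') => p.
have -> : [set w | path w = p] = \bigcap_(l in [set: 'I_m]) [set w | M w (x l) = p l].
  apply/seteqP; split => w /=; first by move=> <- l _; rewrite ffunE.
  by move=> H; apply/ffunP => l; rewrite ffunE; exact: H.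
by apply: fin_bigcap_measurable => // l _; exact: (measurable_mallows mp (p l) (x0 l)).
Qed.

Lemma Pr_trajectory (u : 'I_n -> {ffun 'I_m -> 'I_n}) :
  Pr P [set w | forall j, trajectory j w = u j] = \prod_j Pr P [set w | trajectory j w = u j].
Proof.
pose ts := [seq x l | l <- enum 'I_m].
(* Independence is applied to singleton cylinders. *)
pose B (j : 'I_n) : set (seq nat) := [set v | v = [seq (u j l : nat) | l <- enum 'I_m]].
have BE j w : B j [seq Invj (M w t) j | t <- ts] <-> trajectory j w = u j.
  rewrite /B /ts /= -map_comp; split => [/eq_in_map H|<-].
    apply/ffunP => l; rewrite /trajectory !ffunE; apply: val_inj; rewrite /=.
    by apply: H; rewrite mem_enum.
  by apply/eq_in_map => l _; rewrite /trajectory !ffunE.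
have ts0 t : t \in ts -> 0 <= t by case/mapP => l _ ->.
have := indep B ts0.
have -> : \bigcap_(j in [set: 'I_n]) [set w | B j [seq Invj (M w t) j | t <- ts]] =
    [set w | forall j, trajectory j w = u j].
  by apply/seteqP; split => w /= H j; [apply/BE/H|move=> _; apply/BE/H].
have E j : [set w | B j [seq Invj (M w t) j | t <- ts]] = [set w | trajectory j w = u j].
  by apply/seteqP; split => w /= /BE.
rewrite PrE; last exact: (measurable_trajectory (fun f => forall j, f j = u j)).
rewrite (eq_bigr (fun j => (Pr P [set w | trajectory j w = u j])%:E)); last first.
  by move=> j _; rewrite E PrE//; exact: (measurable_trajectory (fun f => f j = u j)).
by rewrite prodEFin => -[].
Qed.

Lemma Ex_prod_trajectory (g : 'I_n -> {ffun 'I_m -> 'I_n} -> R) :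
  Ex P (fun w => \prod_j g j (trajectory j w)) = \prod_j Ex P (fun w => g j (trajectory j w)).
Proof.
pose traj w : {ffun 'I_n -> {ffun 'I_m -> 'I_n}} := [ffun j => trajectory j w].
transitivity (Ex P (fun w => \prod_j g j (traj w j))).
  by congr Ex; apply/funext => w; apply: eq_bigr => j _; rewrite ffunE.
have trajE u : [set w | traj w = u] = [set w | forall j, trajectory j w = u j].
  apply/seteqP; split => w /=; first by move=> <- j; rewrite ffunE.
  by move=> H; apply/ffunP => j; rewrite ffunE.
rewrite (Ex_fin P (fun u => \prod_j g j (u j)) (xi := traj)); last first.
  by move=> u; rewrite trajE; exact: (measurable_trajectory (fun f => forall j, f j = u j)).
rewrite (eq_bigr (fun j => \sum_v g j v * Pr P [set w | trajectory j w = v])); last first.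
  move=> j _; rewrite (Ex_fin P (g j))// => v.
  exact: (measurable_trajectory (fun f => f j = v)).
rewrite bigA_distr_bigA; apply: eq_bigr => u _.
by rewrite trajE Pr_trajectory big_split.
Qed.

End Trajectories.

Lemma Ex_hpow_Inv (s : seq (nat * R)) : all (fun p => 0 <= p.2) s ->
  Ex P (fun w => hpow (\sum_(p <- s) p.1 * Defs.Inv (M w p.2))%N) =
  \prod_j Ex P (fun w => hpow (Invj_load M j s w)).
Proof.
move=> s0; pose tn l := tnth (in_tuple s) l.
have x0 l : 0 <= (tn l).2 by apply: (allP s0); exact: mem_tnth.
pose g (j : 'I_n) (v : {ffun 'I_(size s) -> 'I_n}) : R := hpow (\sum_l (tn l).1 * v l)%N.
have gE j w : g j (trajectory (fun l => (tn l).2) j w) = hpow (Invj_load M j s w).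
  rewrite /g /Invj_load [in RHS]big_tnth; congr hpow; apply: eq_bigr => l _.
  by rewrite /trajectory !ffunE.
transitivity (Ex P (fun w => \prod_j g j (trajectory (fun l => (tn l).2) j w))).
  congr Ex; apply/funext => w; rewrite (eq_bigr _ (fun j _ => gE j w)) /hpow -expr_sum.
  congr (_ ^+ _); rewrite /Invj_load exchange_big /=; apply: eq_bigr => p _.
  by rewrite Inv_sum big_distrr.
rewrite Ex_prod_trajectory//; apply: eq_bigr => j _; congr Ex; apply/funext => w.
exact: gE.
Qed.

End Independence.

Section RegularLimit.
Context {R : realType} (d : nat -> measure_display)
  (Om : forall n : nat, measurableType (d n)) (P : forall n : nat, probability (Om n) R)
  (M : forall n : nat, Om n -> R -> 'S_n).
Hypothesis rM : forall n, regular_mallows (P n) (@M n).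

Lemma cvg_laplace_regular (s : seq (nat * R)) : all (fun p => 0 <= p.2) s -> time_sorted s ->
  Ex (P n) (fun w => hpow (\sum_(p <- s) p.1 * Defs.Inv (M w (p.2 / n%:R)))%N) @[n --> \oo]
  --> expR (- rate_exponent s).
Proof.
move=> s0 ss; pose sc (n : nat) := [seq (p.1, p.2 / n%:R) | p <- s].
(* A crude common bound for all the times, and hence for [rate_exponent s]. *)
pose X := \sum_(p <- s) p.2.
have sX : all (fun p => 0 <= p.2 <= X) s.
  apply/allP => p ps; rewrite (allP s0 p ps)/= /X (perm_big _ (perm_to_rem ps)) big_cons lerDl.
  by rewrite big_seq sumr_ge0// => q /mem_rem/(allP s0).
have X0 : 0 <= X by rewrite /X big_seq sumr_ge0// => q /(allP s0).
have sc0 n : all (fun p => 0 <= p.2) (sc n).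
  by rewrite all_map; apply: sub_all s0 => p /= p0; rewrite divr_ge0.
have scX n : all (fun p => 0 <= p.2 <= X / n%:R) (sc n).
  rewrite all_map; apply: sub_all sX => p /= /andP[p0 pX].
  by rewrite divr_ge0//= ler_wpM2r// invr_ge0.
have scs n : time_sorted (sc n).
  rewrite /time_sorted /sc sorted_map; apply: sub_sorted ss => p q /= pq.
  by rewrite ler_wpM2r// invr_ge0.
have E n : Ex (P n) (fun w => hpow (\sum_(p <- s) p.1 * Defs.Inv (M w (p.2 / n%:R)))%N) =
    \prod_(j < n) Ex (P n) (fun w => hpow (Invj_load (@M n) j (sc n) w)).
  rewrite -(Ex_hpow_Inv (rM n).1.1.1 (rM n).2 (sc0 n)); congr Ex; apply/funext => w.
  by rewrite /sc big_map.
under eq_fun do rewrite E.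
have cX : rate_exponent s <= X.
  have sX' : all (fun p => p.2 <= X) s by apply: sub_all sX => p /andP[].
  apply: le_trans (rate_exponent_le sX') _.
  by rewrite ler_piMr// lerBlDr lerDl hpow_ge0.
have c0 := rate_exponent_ge0 s0.
(* In the constant, [X] pays for the factor [j = 0], which is exactly 1, and [2 * X ^+ 2] is the
   bound of [Ex_hpow_Invj_load] at X/n. *)
apply: (@cvg_prod_expR R (fun n j => Ex (P n) (fun w => hpow (Invj_load (@M n) j (sc n) w)))
  _ (X + 2 * X ^+ 2)) => //.
- by rewrite addr_ge0// mulr_ge0// sqr_ge0.
- move=> n j; have bl := brv_Invj_load (rM n).1.1 j (sc0 n); apply/andP; split.
    by rewrite -(Ex_cst (P n) 0); apply: Ex_le => // [|w]; [exact: brv_cst|exact: hpow_ge0].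
  by rewrite -(Ex_cst (P n) 1); apply: Ex_le => // [|w]; [exact: brv_cst|exact: hpow_le1].
- move=> n j; have n0 : (0 : R) < n%:R by rewrite ltr0n (leq_ltn_trans _ (ltn_ord j)).
  have n1 : (1 : R) <= n%:R by rewrite ler1n -(ltr0n R).
  have [j0|j0] := posnP (nat_of_ord j).
    rewrite (Ex_hpow_Invj_load0 _ _ _ j0) opprB addrC subrK ger0_norm; last first.
      by rewrite divr_ge0// ltW.
    rewrite ler_wpM2r ?invr_ge0 ?(ltW n0)//; have := sqr_ge0 X; lra.
  have := Ex_hpow_Invj_load (rM n).1.1 j0 (divr_ge0 X0 (ltW n0)) (scs n) (scX n).
  rewrite rate_exponent_scale => /le_trans; apply.
  have H1 : 0 <= X / n%:R by rewrite divr_ge0// ltW.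
  have H2 : (X / n%:R) ^+ 2 <= X ^+ 2 / n%:R.
    rewrite expr_div_n ler_wpM2l ?sqr_ge0// lef_pV2 ?posrE ?exprn_gt0//.
    by rewrite expr2 ler_peMr// ltW.
  rewrite mulrDl; lra.
- move=> n j j0; have n0 : (0 : R) < n%:R by rewrite ltr0n (leq_ltn_trans _ (ltn_ord j)).
  have := Ex_hpow_Invj_load (rM n).1.1 j0 (divr_ge0 X0 (ltW n0)) (scs n) (scX n).
  rewrite rate_exponent_scale => /le_trans; apply.
  rewrite expr_div_n mulrA ler_wpM2r ?invr_ge0 ?exprn_ge0 ?(ltW n0)//; lra.
Qed.

End RegularLimit.

(** * From values at the times to increments *)

Section SummationByParts.
Context {R : realType}.
Implicit Types (s : seq (nat * R)).

(** Abel summation: an increment is counted by every time after it, hence the weight of the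
    remaining list. Monotonicity of [F] makes the truncated subtractions exact. *)
Lemma weighted_sum_by_parts (F : R -> nat) (t0 : R) s :
  path (fun a b => F a <= F b)%N t0 [seq p.2 | p <- s] ->
  (\sum_(p <- s) p.1 * F p.2 = F t0 * weight s + \sum_(i < size s) weight (drop i s) *
    (F (nth 0%R (t0 :: [seq p.2 | p <- s]) i.+1) - F (nth 0%R (t0 :: [seq p.2 | p <- s]) i)))%N.
Proof.
elim: s t0 => [|p s IH] t0 /=; first by rewrite /weight !big_nil big_ord0 muln0.
move=> /andP[t0p ps]; rewrite big_cons (IH _ ps) big_ord_recl /=.
move: (\sum_(i < size s) _)%N => A; rewrite weight_cons.
rewrite -(subnKC t0p) addKn; ring.
Qed.

Lemma rate_exponent_by_parts (t0 : R) s :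
  \sum_(i < size s) (nth 0 (t0 :: [seq p.2 | p <- s]) i.+1 - nth 0 (t0 :: [seq p.2 | p <- s]) i) *
    (1 - hpow (weight (drop i s))) = rate_exponent s - t0 * (1 - hpow (weight s)).
Proof.
elim: s t0 => [|p s IH] t0 /=; first by rewrite big_ord0 /weight big_nil /hpow expr0 subrr mulr0 subrr.
rewrite big_ord_recl /=.
set A := \sum_(i < size s) _.
have -> : A = rate_exponent s - p.2 * (1 - hpow (weight s)) by rewrite -IH.
ring.
Qed.

End SummationByParts.

(** * Laplace functional and hitting times of the Poisson process *)

Section PoissonProcess.
Context {R : realType} {d : measure_display} {T : measurableType d} (Q : probability T R).
Context (N : T -> R -> nat).
Hypothesis pN : poisson_process Q N.

Lemma poisson_counting : counting_process N.
Proof.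
case: pN => _ [mono [rc [mN _]]]; split => // w; split; first exact: mono.
by move=> t t0; exact: rc.
Qed.

(** By parts, the functional is a product over the independent increments, to which
    [Ex_prod_poisson] applies; [rate_exponent_by_parts] reassembles the exponents. *)
Lemma Ex_hpow_poisson (s : seq (nat * R)) : all (fun p => 0 <= p.2) s -> time_sorted s ->
  Ex Q (fun w => hpow (\sum_(p <- s) p.1 * N w p.2)%N) = expR (- rate_exponent s).
Proof.
case: pN => N0 [mono [_ [mN masses]]] s0 ss.
pose ts := [seq p.2 | p <- s]; pose tn := nth 0 (0 :: ts).
have path0 : path <=%R 0 ts.
  rewrite /ts; case: s s0 ss {ts tn} => //= p s /andP[p0 _].
  by rewrite p0 /= path_map.
have tn0 i : 0 <= tn i.
  rewrite /tn; case: i => //= i; have [ti|ti] := ltnP i (size ts); last by rewrite nth_default.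
  by rewrite (nth_map (0%N, 0)) ?(all_nthP _ s0)//; rewrite size_map in ti.
have szts : size ts = size s by rewrite size_map.
pose D w : {ffun 'I_(size s) -> nat} := [ffun i : 'I_(size s) => N w (tn i.+1) - N w (tn i)]%N.
have mD (a : {ffun 'I_(size s) -> nat}) : measurable [set w | D w = a].
  pose V w : {ffun 'I_(size s).+1 -> nat} := [ffun i : 'I_(size s).+1 => N w (tn i)].
  pose S (v : {ffun 'I_(size s).+1 -> nat}) := forall i : 'I_(size s),
    (v (lift ord0 i) - v (widen_ord (leqnSn _) i))%N = a i.
  have -> : [set w | D w = a] = [set w | S (V w)].
    apply/seteqP; split => w; rewrite /S /V /=.
      by move=> <- i; rewrite !ffunE.
    by move=> H; apply/ffunP => i; rewrite -H !ffunE.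
  apply: (measurable_preimage_count S) => v.
  have -> : [set w | V w = v] = \bigcap_(l in [set: 'I_(size s).+1]) [set w | N w (tn l) = v l].
    apply/seteqP; split => w /=; first by move=> <- l _; rewrite ffunE.
    by move=> H; apply/ffunP => l; rewrite ffunE; exact: H.
  by apply: fin_bigcap_measurable => // l _; exact: mN.
have massD (a : {ffun 'I_(size s) -> nat}) :
    Pr Q [set w | D w = a] = \prod_(i < size s) poisson_mass (tn i.+1 - tn i) (a i).
  pose a' := [seq a i | i <- enum 'I_(size s)].
  have a'E (i : 'I_(size s)) : nth 0%N a' i = a i.
    by rewrite (nth_map i) ?size_enum_ord// nth_ord_enum.
  have sza : size a' = size ts by rewrite size_map size_enum_ord szts.
  have := masses ts a' sza path0; rewrite -/tn.
  have -> : [set w | forall i, (i < size ts)%N -> (N w (tn i.+1) - N w (tn i))%N = nth 0%N a' i] =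
      [set w | D w = a].
    apply/seteqP; split => w /= H; last by move=> i; rewrite szts => im;
      rewrite (a'E (Ordinal im)) -H ffunE.
    by apply/ffunP => i; rewrite ffunE H ?szts ?a'E.
  rewrite PrE// szts prodEFin => -[->]; apply: eq_bigr => i _.
  by rewrite a'E.
pose z (i : 'I_(size s)) : R := hpow (weight (drop i s)).
transitivity (Ex Q (fun w => \prod_i z i ^+ D w i)).
  congr Ex; apply/funext => w; rewrite (@weighted_sum_by_parts _ _ 0); last first.
    have mono_path u r : path <=%R u r -> all (fun t => 0 <= t) (u :: r) ->
        path (fun a b => N w a <= N w b)%N u r.
      elim: r u => //= t r IH u /andP[ut tr] /and3P[u0 t0 r0].
      by rewrite mono//=; apply: IH => //=; rewrite t0.
    by apply: mono_path => //; apply/allP => t /(nthP 0)[i _ <-]; exact: tn0.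
  rewrite N0 mul0n add0n /hpow -/ts -/tn; apply/esym.
  rewrite expr_sum; apply: eq_bigr => i _.
  by rewrite /z /hpow ffunE exprM.
rewrite (Ex_prod_poisson (l := fun i : 'I_(size s) => tn i.+1 - tn i) mD massD); last first.
  by move=> i; rewrite hpow_ge0 hpow_le1.
have := rate_exponent_by_parts 0 s; rewrite mul0r subr0 -/ts -/tn => <-.
by rewrite -sumrN (big_morph expR (@expRD R) (@expR0 R)).
Qed.

Lemma Pr_poisson (t : R) a : 0 <= t -> Pr Q [set w | N w t = a] = poisson_mass t a.
Proof.
case: pN => N0 [mono [_ [mN masses]]] t0.
have := masses [:: t] [:: a] erefl; rewrite /= t0 => /(_ isT).
have -> : [set w | forall i, (i < 1)%N -> (N w (nth 0%R [:: t] i) - N w (nth 0%R [:: 0%R; t] i))%N =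
    nth 0%N [:: a] i] = [set w | N w t = a].
  apply/seteqP; split => w /=; first by move=> /(_ 0%N isT) /=; rewrite N0 subn0.
  by move=> <- [|i] //= _; rewrite N0 subn0.
by rewrite /= PrE; [rewrite big_ord1 /= subr0 => -[]|exact: mN].
Qed.

(** The probability of fewer than [k] points by time t is [gamma_tail k t], which tends to 0. *)
Lemma Pr_never_poisson k : Pr Q (never N k) = 0.
Proof.
apply: (Pr_never poisson_counting) => e e0.
have := @cvg_gamma_tail R k => /cvgrPdist_lt/(_ e e0) H.
have [t [t0 Ht]] : exists t : R, 0 < t /\ `|0 - gamma_tail k t| < e.
  near (pinfty_nbhs R) => t; exists t; split; first by near: t; exact: nbhs_pinfty_gt.
  by near: t.
exists t; first exact: ltW.
rewrite (Pr_nat_lt Q (xi := N ^~ t)); last first.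
  by move=> a; apply: poisson_counting.2; exact: ltW.
rewrite (eq_bigr (fun a : 'I_k => poisson_mass t a)); last first.
  by move=> a _; rewrite Pr_poisson// ltW.
by move: Ht; rewrite sub0r normrN => Ht; rewrite ltW// (le_lt_trans (ler_norm _) Ht).
Unshelve. all: by end_near. Qed.

End PoissonProcess.

Section RegularJumpTimes.
Context {R : realType} (d : nat -> measure_display)
  (Om : forall n : nat, measurableType (d n)) (P : forall n : nat, probability (Om n) R)
  (M : forall n : nat, Om n -> R -> 'S_n).
Hypothesis rM : forall n, regular_mallows (P n) (@M n).
Context (d' : measure_display) (Om' : measurableType d') (Q : probability Om' R)
  (N : Om' -> R -> nat).
Hypothesis pN : poisson_process Q N.

Lemma regular_monotone n : monotone_mallows (P n) (@M n).
Proof.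
have [[[mp sm] _] _] := rM n; split => // w t t' t0 tt'.
by rewrite !Inv_sum; apply: leq_sum => j _; exact: sm.
Qed.

Lemma cvg_Pr_counting_tests (s : seq (nat * R)) : all (fun p => 0 <= p.2) s -> time_sorted s ->
  Pr (P n) [set w | all (fun p => p.1 <= Defs.Inv (M w (p.2 / n%:R)))%N s] @[n --> \oo] -->
  Pr Q [set w | all (fun p => p.1 <= N w p.2)%N s].
Proof.
move=> s0 ss; pose tn l := tnth (in_tuple s) l.
have x0 l : 0 <= (tn l).2 by apply: (allP s0); exact: mem_tnth.
pose V n (w : Om n) : {ffun 'I_(size s) -> nat} := [ffun l => Defs.Inv (M w ((tn l).2 / n%:R))].
pose V' w : {ffun 'I_(size s) -> nat} := [ffun l => N w (tn l).2].
have mV n v : measurable [set w : Om n | V n w = v].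
  have -> : [set w : Om n | V n w = v] = \bigcap_(l in [set: 'I_(size s)])
      [set w | Defs.Inv (M w ((tn l).2 / n%:R)) = v l].
    apply/seteqP; split => w /=; first by move=> <- l _; rewrite ffunE.
    by move=> H; apply/ffunP => l; rewrite ffunE; exact: H.
  apply: fin_bigcap_measurable => // l _.
  apply: (mallows_counting (regular_monotone n)).2; exact: divr_ge0.
have mV' v : measurable [set w | V' w = v].
  have -> : [set w | V' w = v] = \bigcap_(l in [set: 'I_(size s)]) [set w | N w (tn l).2 = v l].
    apply/seteqP; split => w /=; first by move=> <- l _; rewrite ffunE.
    by move=> H; apply/ffunP => l; rewrite ffunE; exact: H.
  by apply: fin_bigcap_measurable => // l _; apply: (poisson_counting pN).2.
have lap (r : 'I_(size s) -> nat) : Ex (P n) (fun w => half_pow r (V n w)) @[n --> \oo] -->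
    Ex Q (fun w => half_pow r (V' w)).
  (* The Laplace weights [r] replace the levels of [s]; the times and their order are unchanged. *)
  pose sr := [seq (r l, (tn l).2) | l <- enum 'I_(size s)].
  have sr0 : all (fun p => 0 <= p.2) sr by rewrite all_map; apply/allP => l _ /=.
  have srs : time_sorted sr.
    have E (u : seq (nat * R)) : time_sorted u = sorted <=%R [seq p.2 | p <- u].
      by rewrite sorted_map.
    rewrite E (_ : [seq p.2 | p <- sr] = [seq p.2 | p <- s]) -?E//.
    have Es : s = [seq tn l | l <- enum 'I_(size s)] := esym (map_tnth_enum (in_tuple s)).
    by rewrite [in RHS]Es -!map_comp.
  have -> : Ex Q (fun w => half_pow r (V' w)) = expR (- rate_exponent sr).
    rewrite -(Ex_hpow_poisson pN sr0 srs); congr Ex; apply/funext => w.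
    by rewrite /half_pow /hpow big_map big_enum; congr (_ ^+ _); apply: eq_bigr => l _; rewrite ffunE.
  have E n : Ex (P n) (fun w => half_pow r (V n w)) =
      Ex (P n) (fun w => hpow (\sum_(p <- sr) p.1 * Defs.Inv (M w (p.2 / n%:R)))%N).
    congr Ex; apply/funext => w.
    by rewrite /half_pow /hpow big_map big_enum; congr (_ ^+ _); apply: eq_bigr => l _; rewrite ffunE.
  by under eq_fun do rewrite E; exact: cvg_laplace_regular.
have H : Pr (P n) [set w | [forall l, (tn l).1 <= V n w l]%N] @[n --> \oo] -->
    Pr Q [set w | [forall l, (tn l).1 <= V' w l]%N].
  exact: (cvg_Pr_of_laplace mV mV' lap (b := fun l => (tn l).1)).
have E1 n : [set w | all (fun p => p.1 <= Defs.Inv (M w (p.2 / n%:R)))%N s] =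
    [set w | [forall l, (tn l).1 <= V n w l]%N].
  apply/seteqP; split => w /=.
    by move=> /(all_tnthP (t := in_tuple s)) H1; apply/forallP => l; rewrite ffunE; exact: H1.
  move=> /forallP H1; apply/(all_tnthP (t := in_tuple s)) => l.
  by have := H1 l; rewrite ffunE.
have E2 : [set w | all (fun p => p.1 <= N w p.2)%N s] = [set w | [forall l, (tn l).1 <= V' w l]%N].
  apply/seteqP; split => w /=.
    by move=> /(all_tnthP (t := in_tuple s)) H1; apply/forallP => l; rewrite ffunE; exact: H1.
  move=> /forallP H1; apply/(all_tnthP (t := in_tuple s)) => l.
  by have := H1 l; rewrite ffunE.
by rewrite E2; under eq_fun do rewrite E1; exact: H.
Qed.

Theorem cvg_jump_times_poisson k (f : 'rV[R]_k -> R) C : continuous f -> (forall v, `|f v| <= C) ->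
  ((fun n : nat => \int[P n]_w (f (\row_(i < k) (n%:R * jump_time (M w) i.+1)))%:E) @ \oo
      --> \int[Q]_w (f (\row_(i < k) kth_point (N w) i.+1))%:E)%E.
Proof.
move=> cf fC; pose Y n (w : Om n) (i : 'I_k) : R := n%:R * jump_time (M w) i.+1.
pose Y' w (i : 'I_k) : R := kth_point (N w) i.+1.
have mY n i : measurable_fun setT (Y n ^~ i) by exact: measurable_jump_time (regular_monotone n) _.
have Y0 n w i : 0 <= Y n w i by exact: jump_time_ge0.
have mY' i : measurable_fun setT (Y' ^~ i).
  exact: (measurable_kth_point (poisson_counting pN)).
have Y'0 w i : 0 <= Y' w i by exact: kth_point_ge0.
have cdf (s : seq ('I_k * R)) : all (fun p => 0 <= p.2) s ->
    Pr (P n) [set w | all (fun p => Y n w p.1 <= p.2) s] @[n --> \oo] -->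
    Pr Q [set w | all (fun p => Y' w p.1 <= p.2) s].
  move=> s0; pose le2 (p q : nat * R) := p.2 <= q.2.
  (* The tests come in any order and may repeat a coordinate, whereas the functionals require sorted
     times; the index is shifted because coordinate [i] carries the jump [i.+1]. *)
  pose ss := sort le2 [seq (p.1.+1, p.2) | p : 'I_k * R <- s].
  have allss (a : pred (nat * R)) : all a ss = all (fun p : 'I_k * R => a (p.1.+1, p.2)) s.
    by rewrite (perm_all a (permEl (perm_sort le2 _))) all_map.
  have ssk : all (fun p => (p.1 <= k)%N && (0 <= p.2)) ss.
    by rewrite allss; apply: sub_all s0 => p /= ->; rewrite ltn_ord.
  have ss0 : all (fun p => 0 <= p.2) ss by apply: sub_all ssk => p /andP[].
  have sss : time_sorted ss by apply: sort_sorted => p q; exact: le_total.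
  have L := cvg_Pr_counting_tests ss0 sss.
  have EQ : Pr Q [set w | all (fun p => p.1 <= N w p.2)%N ss] =
      Pr Q [set w | all (fun p => Y' w p.1 <= p.2) s].
    rewrite -(Pr_kth_point_tests (poisson_counting pN) ssk (Pr_never_poisson pN k)).
    by congr Pr; apply/seteqP; split => w; rewrite /= allss.
  rewrite -EQ; apply: cvg_trans L; apply: near_eq_cvg.
  near=> n; have kn : (k < n)%N by near: n; exact: nbhs_infty_gt.
  suff -> : Pr (P n) [set w | all (fun p => Y n w p.1 <= p.2) s] =
      Pr (P n) [set w | all (fun p => p.1 <= Defs.Inv (M w (p.2 / n%:R)))%N ss] by [].
  rewrite -(Pr_jump_time_tests (regular_monotone n) ssk kn).
  by congr Pr; apply/seteqP; split => w; rewrite /= allss.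
have H := weak_cvg_of_cdf mY Y0 mY' Y'0 cdf cf fC.
have -> : (fun n : nat => \int[P n]_w (f (\row_(i < k) (n%:R * jump_time (M w) i.+1)))%:E)%E =
    EFin \o (fun n => Ex (P n) (fun w => f (\row_i Y n w i))).
  apply/funext => n /=; apply: integral_brv.
  exact: (brv_continuous (mY n) (Y0 n) cf fC).
rewrite (integral_brv Q (brv_continuous mY' Y'0 cf fC)).
by apply: cvg_EFin; [exact: nearW|exact: H].
Unshelve. all: by end_near. Qed.

End RegularJumpTimes.

Theorem theorem3 (R : realType) (d : nat -> measure_display)
  (Omega : forall n : nat, measurableType (d n))
  (P : forall n : nat, probability (Omega n) R)
  (M : forall n : nat, Omega n -> R -> 'S_n)
  (HM : forall n : nat, monotone_mallows (P n) (M n)) :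
  (* n T_k --> Gamma(k,1) in distribution *)
  (forall k : nat, (0 < k)%N ->
    forall f : R -> R, continuous f -> bounded_fun f ->
    ((fun n : nat => \int[P n]_w (f (n%:R * jump_time (M n w) k))%:E) @ \oo
      --> \int[lebesgue_measure]_(x in [set x : R | (0 <= x)%R]) (f x * gamma_pdf k x)%:E)%E)
  /\
  (* under regularity: (n T_1, ..., n T_k) --> first k points of a rate-1 PPP *)
  ((forall n : nat, regular_mallows (P n) (M n)) ->
    forall k : nat, (0 < k)%N ->
    forall (d' : measure_display) (Omega' : measurableType d')
      (Q : probability Omega' R) (N : Omega' -> R -> nat),
    poisson_process Q N ->
    forall f : 'rV[R]_k -> R, continuous f -> bounded_fun f ->
    ((fun n : nat => \int[P n]_w (f (\row_(i < k) (n%:R * jump_time (M n w) i.+1)))%:E) @ \oo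
      --> \int[Q]_w (f (\row_(i < k) kth_point (N w) i.+1))%:E)%E).
Proof.
(* [bounded_fun] asserts the bound for all constants beyond a threshold [C]; [C + 1] is one of
   them. *)
have bound (V : Type) (f : V -> R) : bounded_fun f -> exists C, forall v, `|f v| <= C.
  by move=> [C [_ fC]]; exists (C + 1) => v; apply: fC; rewrite ?ltrDl.
split=> [[//|k] _ f cf /bound[C fC]|rM k _ d' Omega' Q N pN f cf /bound[C fC]].
  exact: (cvg_jump_time_gamma HM cf fC).
exact: (cvg_jump_times_poisson rM pN cf fC).
Qed.
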